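(* Consider the horizontally homogeneous specialization $y_j=1$ and $s_j=s$ for all $j\ge 1$. Let $\lambda=(\lambda_1\ge\ldots\ge\lambda_N\ge 0)$ be a signature with $N$ parts. Then $$\frac{F_\lambda(x_1,\ldots,x_N;\mathbf{y};\mathbf{r};\mathbf{s})}{F_{(0,\ldots,0)}(x_1,\ldots,x_N;\mathbf{y};\mathbf{r};\mathbf{s})}=s_\lambda\left(\frac{1-s^2x_1}{s^2(1-x_1)},\ldots,\frac{1-s^2x_N}{s^2(1-x_N)}\right),$$ where $s_\lambda$ is the ordinary Schur symmetric polynomial in $N$ variables and $\mathbf r=(r_1,\ldots,r_N)$. Moreover, for any $M\ge1$ and $\mathbf r=(r_1,\ldots,r_M)$, $$G_\lambda(x_1,\ldots,x_M;\mathbf{y};\mathbf{r};\mathbf{s})=s_\lambda\left(\Bigl\{\tfrac{s^2(1-x_j)}{1-s^2x_j}\Bigr\}_{j=1}^M\Big/\Bigl\{\tfrac{s^2(x_jr_j^{-2}-1)}{1-s^2r_j^{-2}x_j}\Bigr\}_{j=1}^M\right)\prod_{i=1}^M\left(\frac{1-s^2r_i^{-2}x_i}{1-s^2x_i}\right)^N,$$ where $s_\lambda(\cdot/\cdot)$ denotes the supersymmetric Schur function.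
   Context: Signatures. A signature with $N$ parts is an integer sequence $\lambda=(\lambda_1\ge\ldots\ge\lambda_N\ge0)$; $\varnothing$ is the signature with $0$ parts; $\mathcal S(\lambda)=\{\lambda_j+N+1-j:1\le j\le N\}\subset\mathbb Z_{\ge1}$. Vertex weights. For $i_1,j_1,i_2,j_2\in\{0,1\}$ (numbers of paths entering from the bottom, entering from the left, exiting at the top, exiting to the right) put $W(\cdot)=W(\cdot\mid x;y;r;s)$ with $W(0,0;0,0)=1$, $W(1,1;1,1)=\frac{r^{-2}x-y}{s^{-2}y-x}$, $W(1,0;1,0)=\frac{s^{-2}y-r^{-2}x}{s^{-2}y-x}$, $W(0,1;0,1)=\frac{y-x}{s^{-2}y-x}$, $W(1,0;0,1)=\frac{x(r^{-2}-1)}{s^{-2}y-x}$, $W(0,1;1,0)=\frac{y(s^{-2}-1)}{s^{-2}y-x}$, and $W=0$ otherwise. Put $\widehat W(i_1,j_1;i_2,j_2)=W(i_1,j_1;i_2,j_2)/W(0,1;0,1)$. Partition functions. Let $\mathbf x=(x_1,\ldots,x_k)$, $\mathbf r=(r_1,\ldots,r_k)$, $\mathbf y=(y_1,y_2,\ldots)$, $\mathbf s=(s_1,s_2,\ldots)$. A configuration on $\mathbb Z_{\ge1}\times\{1,\ldots,k\}$ consists of vertical edge states $v(i,j)\in\{0,1\}$ ($i\ge1$, $0\le j\le k$; $v(i,j-1)$ is below and $v(i,j)$ above the vertex $(i,j)$) and horizontal edge states $h(i,j)\in\{0,1\}$ ($i\ge0$, $1\le j\le k$; $h(i-1,j)$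 is to the left and $h(i,j)$ to the right of $(i,j)$). For $\lambda$ with $N$ parts, $G_\lambda(\mathbf x;\mathbf y;\mathbf r;\mathbf s)$ is the sum over configurations with $v(i,0)=\mathbf 1_{1\le i\le N}$, $v(i,k)=\mathbf 1_{i\in\mathcal S(\lambda)}$, $h(0,j)=0$, and $h(i,j)=0$ for all large $i$, of $\prod_{i,j}W(v(i,j-1),h(i-1,j);v(i,j),h(i,j)\mid x_j;y_i;r_j;s_i)$. For $\lambda$ with $k$ parts, $F_\lambda(\mathbf x;\mathbf y;\mathbf r;\mathbf s)$ is the sum over configurations with $v(i,0)=\mathbf 1_{i\in\mathcal S(\lambda)}$, $v(i,k)=0$, $h(0,j)=0$, and $h(i,j)=1$ for all large $i$, of the same product with $\widehat W$ in place of $W$. Both sums have finitely many nonzero terms, and in each of them all but finitely many factors equal $1$. Identities are between rational functions: parameters are assumed such that no denominator vanishes. Supersymmetric Schur functions. For $\mathbf a=(a_1,\ldots,a_M)$, $\mathbf b=(b_1,\ldots,b_M)$, the functions $s_\lambda(\mathbf a/\mathbf b)$ are defined as the coefficients in $\sum_{\lambda=(\lambda_1\ge\ldots\ge\lambda_N\ge0)}s_\lambda(\mathbf a/\mathbf b)\,s_\lambda(t_1,\ldots,t_N)=\prod_{i=1}^N\prod_{j=1}^M\frac{1+t_ib_j}{1-t_ia_j}$ (power series in the $t_i$), where $s_\lambda(t_1,\ldots,t_N)$ are the ordinary Schur polynomials. *)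

(* Defs.v *)
From HB Require Import structures.
From mathcomp Require Import all_boot all_order all_algebra.
From mathcomp Require Import boolp classical_sets fsbigop.
From mathcomp Require Import mpoly.

Set Implicit Arguments.
Unset Strict Implicit.
Unset Printing Implicit Defensive.

Import GRing.Theory.

Local Open Scope classical_set_scope.
Local Open Scope ring_scope.

Definition signature (N : nat) := {l : N.-tuple nat | sorted geq l}.

Definition part (N : nat) (lambda : signature N) (j : 'I_N) : nat :=
  tnth (val lambda) j.

Lemma sorted_nseq0 (N : nat) : sorted geq (nseq_tuple N 0%N).
Proof. by rewrite /=; case: N => //=; elim=> //= n ->. Qed.

Definition signature0 (N : nat) : signature N :=
  exist (fun l : N.-tuple nat => sorted geq l) (nseq_tuple N 0%N)
    (sorted_nseq0 N).

(* The set {lambda_j + N + 1 - j : 1 <= j <= N} of positive integers; here j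
   is 0-based, whence N - j. *)
Definition particles (N : nat) (lambda : signature N) (i : nat) : bool :=
  [exists j : 'I_N, i == (part lambda j + (N - j))%N].

Section Weights.
Variable K : fieldType.

Definition weight (x y r s : K) (i1 j1 i2 j2 : bool) : K :=
  match i1, j1, i2, j2 with
  | false, false, false, false => 1
  | true,  true,  true,  true  => (r ^- 2 * x - y) / (s ^- 2 * y - x)
  | true,  false, true,  false => (s ^- 2 * y - r ^- 2 * x) / (s ^- 2 * y - x)
  | false, true,  false, true  => (y - x) / (s ^- 2 * y - x)
  | true,  false, false, true  => x * (r ^- 2 - 1) / (s ^- 2 * y - x)
  | false, true,  true,  false => y * (s ^- 2 - 1) / (s ^- 2 * y - x)
  | _, _, _, _ => 0
  end.

Definition weight_hat (x y r s : K) (i1 j1 i2 j2 : bool) : K :=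
  weight x y r s i1 j1 i2 j2 / weight x y r s false true false true.

Lemma weight_nonconserving (x y r s : K) (i1 j1 i2 j2 : bool) :
  (i1 + j1)%N != (i2 + j2)%N -> weight x y r s i1 j1 i2 j2 = 0.
Proof. by case: i1 j1 i2 j2 => [] [] [] []. Qed.

End Weights.

(* Columns and rows are numbered from 0, so (i, j) below is the vertex
   (i + 1, j + 1) in 1-based coordinates, and vert c i _ lives in column i + 1;
   levels of vertical edges (0..k) and horizontal positions (0, 1, ..) keep
   their numbering. *)
Definition config (k : nat) : Type :=
  ((nat -> 'I_k.+1 -> bool) * (nat -> 'I_k -> bool))%type.

Section Partition.
Variables (K : fieldType) (k : nat).
Implicit Types (c : config k) (i : nat) (j : 'I_k).

Definition vert c (i : nat) (l : 'I_k.+1) : bool := c.1 i l.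
Definition horiz c (i : nat) (j : 'I_k) : bool := c.2 i j.

Definition below c i j : bool := vert c i (widen_ord (leqnSn k) j).
Definition above c i j : bool := vert c i (lift ord0 j).
Definition left c i j : bool := horiz c i j.
Definition right c i j : bool := horiz c i.+1 j.

(* Paths neither start nor end at a vertex.  Configurations violating this
   have weight 0 (weight_nonconserving), so leaving them out of the sums loses
   nothing.  It has to be done explicitly, since they may have infinitely many
   factors different from 1 and a finitely supported product is then 1 by
   convention. *)
Definition conserving c : Prop :=
  forall i j, (below c i j + left c i j)%N = (above c i j + right c i j)%N.

Definition configs (bottom top : nat -> bool) (out : bool) : set (config k) :=
  [set c | [/\ conserving c,
    forall i, vert c i ord0 = bottom i.+1,
    forall i, vert c i ord_max = top i.+1,
    forall j, horiz c 0 j = false &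
    exists L, forall i j, (L <= i)%N -> horiz c i j = out]].

Definition config_weight (w : nat -> 'I_k -> bool -> bool -> bool -> bool -> K)
    c : K :=
  \big[*%R/1]_(p \in [set: nat * 'I_k])
    w p.1 p.2 (below c p.1 p.2) (left c p.1 p.2)
              (above c p.1 p.2) (right c p.1 p.2).

Definition partition_function
    (w : nat -> 'I_k -> bool -> bool -> bool -> bool -> K)
    (bottom top : nat -> bool) (out : bool) : K :=
  \sum_(c \in configs bottom top out) config_weight w c.

End Partition.

(* y i and s i stand for y_(i+1) and s_(i+1). *)
Definition G (K : fieldType) (k N : nat) (lambda : signature N)
    (x : 'I_k -> K) (y : nat -> K) (r : 'I_k -> K) (s : nat -> K) : K :=
  partition_function (fun i j => weight (x j) (y i) (r j) (s i))
    (fun i => (1 <= i <= N)%N) (particles lambda) false.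

Definition F (K : fieldType) (k : nat) (lambda : signature k)
    (x : 'I_k -> K) (y : nat -> K) (r : 'I_k -> K) (s : nat -> K) : K :=
  partition_function (fun i j => weight_hat (x j) (y i) (r j) (s i))
    (particles lambda) (fun=> false) true.

Section Schur.
Variables (K : fieldType) (N : nat).

Definition vandermonde : {mpoly K[N]} :=
  \prod_(i < N) \prod_(j < N | (i < j)%N) ('X_i - 'X_j).

(* det (X_i ^ (lambda_j + N - j)) with j running from 1 to N. *)
Definition alternant (lambda : signature N) : {mpoly K[N]} :=
  \det (\matrix_(i < N, j < N) 'X_i ^+ (part lambda j + (N - j.+1))).

(* The bialternant formula alternant / vandermonde.  The quotient in
   {mpoly K[N]} exists, and is unique since this ring is a domain. *)
Definition schur (lambda : signature N) : {mpoly K[N]} :=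
  xget 0 [set p | p * vandermonde = alternant lambda].

Definition schur_eval (lambda : signature N) (u : 'I_N -> K) : K :=
  (schur lambda).@[u].

End Schur.

Section Supersymmetric.
Variables (K : fieldType) (M N : nat) (a b : 'I_M -> K).

(* The coefficient of t^m in the power series
   prod_(i, j) (1 + t_i b_j) / (1 - t_i a_j).  Each 1 / (1 - t_i a_j) is the
   geometric series, whose terms of degree above mdeg m do not matter. *)
Definition cauchy_coef (m : 'X_{1..N}) : K :=
  (\prod_(i < N) \prod_(j < M)
     ((1 + b j *: 'X_i) * \sum_(n < (mdeg m).+1) (a j *: 'X_i) ^+ n)
     : {mpoly K[N]})@_m.

(* Equality of power series in t_1, .., t_N, coefficient by coefficient.  The
   sum over lambda is finite because schur lambda is homogeneous of degree
   |lambda|. *)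
Definition cauchy_expansion (c : signature N -> K) : Prop :=
  forall m : 'X_{1..N},
    \sum_(lambda \in [set: signature N]) c lambda * (schur K lambda)@_m
    = cauchy_coef m.

(* There is exactly one such family, the Schur polynomials in N variables being
   a basis of the symmetric ones. *)
Definition super_schur : signature N -> K :=
  xget (fun=> 0) [set c | cauchy_expansion c].

End Supersymmetric.

(* Main.v *)
(** In the horizontally homogeneous case every row of vertices is
    free-fermionic: [w1111 + w1010 * w0101 = w1001 * w0110].  Send the occupied
    columns [p_1 > ... > p_N] of a state to the alternant [T_p1 ^ ... ^ T_pN] of
    the vectors [T_i = (t_k ^ i)_k].  The free-fermionic relation says exactly
    that summing over the outputs of a row replaces each [T_i] by one vector
    [P_i = w1010 T_i + w1001 E_(i+1)], where [E_i = w0110 T_i + w0101 E_(i+1)]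
    follows a single path.  If no path exits, [P_i] is [T_i] times the series
    [w1010 (1 + b t) / (1 - a t)], which gives the Cauchy expansion of [G] after
    division by the Vandermonde determinant.  If a path exits, [E] keeps a
    component [a ^ (L - i)], which amounts to a new variable [1 / a] in the
    alternant; this gives [F] by induction on the number of rows. *)

Require Import Defs.
From mathcomp Require Import all_boot all_order all_algebra.
From mathcomp Require Import boolp classical_sets fsbigop.
From mathcomp Require Import fingroup perm mpoly ring zify.

Set Implicit Arguments.
Unset Strict Implicit.
Unset Printing Implicit Defensive.

Import GRing.Theory.

Local Open Scope ring_scope.

(** * Alternating products and one row of vertices *)

(** On the [F] side the obstacle is division. The values at which the Schur polynomial is evaluated
    may coincide, and then alternant and Vandermonde both vanish. So the induction on rows carries a
    polynomial [S] with [S * vandermonde = alternant]; each row specialises one variable of [S], and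
    the Vandermonde is cancelled while the remaining variables are still free. The new variable is
    [u = 1 / a] because [a ^ (L - i) = a ^ L * u ^ i]: up to a factor independent of [i], the exit
    coordinate is a row of powers of [u]. The factors picked up on the way do not depend on the
    signature and disappear in the quotient by the value at the zero signature. On the [G] side the
    obstacle is that the objects are infinite. The strip is cut after [L] columns, and power series
    become polynomials compared in degrees below [L]; cutting the geometric series at the last
    column only changes terms of degree at least [L]. Division by the Vandermonde determinant costs
    its degree in precision, so [L] is chosen anew for each coefficient of the Cauchy expansion. *)

Definition wedge (R : comNzRingType) n (cs : seq 'rV[R]_n) : R :=
  if size cs == n then \det (\matrix_(i < n) nth 0 cs i) else 0.

Lemma wedge_linear (R : comNzRingType) n (c1 c2 : seq 'rV[R]_n) a b u v :
  wedge (c1 ++ (a *: u + b *: v) :: c2)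
  = a * wedge (c1 ++ u :: c2) + b * wedge (c1 ++ v :: c2).
Proof.
rewrite /wedge !size_cat /=; case: eqP => [szE|_]; last by rewrite !mulr0 addr0.
have lt_c1 : (size c1 < n)%N by move: szE; lia.
have nth_off w i j : i != size c1 ->
    nth 0 (c1 ++ w :: c2) i 0 j = nth 0 (c1 ++ 0 :: c2) i 0 j.
  move=> ne_i; rewrite !nth_cat.
  by case: ltngtP ne_i => // lt_i _; rewrite -(subnSK lt_i).
have row'E w w' : row' (Ordinal lt_c1) (\matrix_(i < n) nth 0 (c1 ++ w :: c2) i)
    = row' (Ordinal lt_c1) (\matrix_(i < n) nth 0 (c1 ++ w' :: c2) i).
  apply/matrixP => i j; rewrite !mxE !(nth_off _ (lift _ i)) //;
  by have := neq_lift (Ordinal lt_c1) i; rewrite -val_eqE eq_sym.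
apply: (determinant_multilinear (i0 := Ordinal lt_c1)) => //.
by rewrite !rowK /= !nth_cat ltnn subnn.
Qed.

Lemma wedge_alternate (R : comNzRingType) n (c1 c2 : seq 'rV[R]_n) u :
  wedge (c1 ++ u :: u :: c2) = 0.
Proof.
rewrite /wedge !size_cat /=; case: eqP => [szE|//].
have lt_c1 : (size c1 < n)%N by move: szE; lia.
have lt_c2 : ((size c1).+1 < n)%N by move: szE; lia.
apply: (determinant_alternate (i1 := Ordinal lt_c1) (i2 := Ordinal lt_c2)).
  by rewrite -val_eqE /= ltn_eqF.
by move=> j; rewrite !mxE /= !nth_cat ltnn subnn ltnNge leqnSn subSnn.
Qed.

Lemma wedge0 (R : comNzRingType) n (c1 c2 : seq 'rV[R]_n) :
  wedge (c1 ++ 0 :: c2) = 0.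
Proof.
by have := wedge_linear c1 c2 0 0 0 0; rewrite !scale0r addr0 !mul0r addr0.
Qed.

(** Polarisation of [wedge_alternate] at [u + v]. *)
Lemma wedge_swap (R : comNzRingType) n (c1 c2 : seq 'rV[R]_n) u v :
  wedge (c1 ++ u :: v :: c2) = - wedge (c1 ++ v :: u :: c2).
Proof.
have addE c1' c2' : wedge (c1' ++ (u + v) :: c2')
    = wedge (c1' ++ u :: c2') + wedge (c1' ++ v :: c2').
  by have := wedge_linear c1' c2' 1 1 u v; rewrite !scale1r !mul1r.
have := wedge_alternate c1 c2 (u + v); rewrite addE.
have := addE (rcons c1 u) c2; have := addE (rcons c1 v) c2.
rewrite !cat_rcons !wedge_alternate => -> ->; rewrite add0r addr0 => /eqP.
by rewrite addr_eq0 => /eqP.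
Qed.

(** This is where the free-fermionic relation will act: for two paths entering the same vertex, the
    2 x 2 determinant is [w1010 w0101 - w1001 w0110], that is [- w1111]. *)
Lemma wedge2 (R : comNzRingType) n (c1 c2 : seq 'rV[R]_n) a b c d u v :
  wedge (c1 ++ (a *: u + b *: v) :: (c *: u + d *: v) :: c2)
  = (a * d - b * c) * wedge (c1 ++ u :: v :: c2).
Proof.
rewrite wedge_linear.
have := wedge_linear (rcons c1 u) c2 c d u v; rewrite !cat_rcons => ->.
have := wedge_linear (rcons c1 v) c2 c d u v; rewrite !cat_rcons => ->.
by rewrite !wedge_alternate (wedge_swap _ _ v); ring.
Qed.

Lemma sum_tuple0 (V : nmodType) (T : finType) (F : 0.-tuple T -> V) :
  \sum_(t : 0.-tuple T) F t = F [tuple].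
Proof.
rewrite (bigD1 [tuple]) //= big1 ?addr0 // => t.
by case/eqP; apply: val_inj; apply: size0nil; rewrite size_tuple.
Qed.

Lemma sum_tupleS (V : nmodType) (T : finType) n
    (F : n.+1.-tuple T -> V) :
  \sum_(t : n.+1.-tuple T) F t
  = \sum_(x : T) \sum_(t : n.-tuple T) F [tuple of x :: t].
Proof.
rewrite pair_bigA /=.
rewrite (reindex (fun p : T * n.-tuple T => [tuple of p.1 :: p.2])) //.
exists (fun t => (thead t, [tuple of behead t])) => [[x t]|t] _ /=.
  by congr pair; apply: val_inj.
by rewrite -tuple_eta.
Qed.

Definition vertex_weight (R : Type) : Type := bool -> bool -> bool -> bool -> R.

Definition free_fermionic (R : comNzRingType) (w : vertex_weight R) : Prop :=
  [/\ w false false false false = 1,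
      forall i1 j1 i2 j2 : bool, (i1 + j1 != i2 + j2)%N -> w i1 j1 i2 j2 = 0 &
      w true true true true + w true false true false * w false true false true
      = w true false false true * w false true true false].

Fixpoint row_weight (R : comNzRingType) (w : vertex_weight R) (h out : bool)
    (v v' : seq bool) : R :=
  match v, v' with
  | [::], [::] => (h == out)%:R
  | a :: v1, b :: v1' =>
      w a h b false * row_weight w false out v1 v1'
      + w a h b true * row_weight w true out v1 v1'
  | _, _ => 0
  end.

(* Decreasing in the index, like the exponents of an alternant. *)
Fixpoint occupied (V : Type) (T : nat -> V) (i : nat) (v : seq bool) : seq V :=
  if v is b :: v1 then
    occupied T i.+1 v1 ++ (if b then [:: T i] else [::])
  else [::].

(* [E i] stands for a path entering column [i] from the left: it is what
   becomes of this path by the last column [L]. *)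
Lemma row_wedge (R : comNzRingType) (w : vertex_weight R) n L
    (T E : nat -> 'rV[R]_n) (h : bool) (i : nat) (v : seq bool)
    (cs : seq 'rV[R]_n) :
  free_fermionic w ->
  (forall k, (k < L)%N ->
     E k = w false true true false *: T k + w false true false true *: E k.+1) ->
  (i + size v = L)%N ->
  \sum_(v' : (size v).-tuple bool)
     (row_weight w h false v v' * wedge (occupied T i v' ++ cs)
      + row_weight w h true v v' * wedge (E L :: occupied T i v' ++ cs))
  = wedge (occupied (fun k => w true false true false *: T k
                              + w true false false true *: E k.+1) i v
           ++ (if h then E i :: cs else cs)).
Proof.
move=> [w0 wN wF] recE; elim: v => [|a v IHv] /= in h i cs *.
  rewrite addn0 => <-; rewrite sum_tuple0.
  by case: h; rewrite /= !mul1r !mul0r ?add0r ?addr0.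
rewrite addnS -addSn => szL.
have lt_i : (i < L)%N by move: szL; lia.
rewrite sum_tupleS /= big_bool /=.
(* [S h' b] is what remains of the row once the vertex in column [i] has emitted [h'] to the right
   and [b] upwards. A path emitted upwards joins [cs], which is why the induction needs arbitrary
   [cs]. *)
pose S h' b := \sum_(t : (size v).-tuple bool)
  (row_weight w h' false v t
     * wedge ((occupied T i.+1 t ++ (if b then [:: T i] else [::])) ++ cs)
   + row_weight w h' true v t
     * wedge (E L :: (occupied T i.+1 t ++ (if b then [:: T i] else [::])) ++ cs)).
have SE h' b : S h' b = wedge (occupied (fun k => w true false true false *: T k
        + w true false false true *: E k.+1) i.+1 v
      ++ (let cs' := if b then T i :: cs else cs in
          if h' then E i.+1 :: cs' else cs')).
  rewrite -IHv //; apply: eq_bigr => t _.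
  by rewrite -!catA; case: b.
transitivity (w a h true false * S false true + w a h true true * S true true
  + (w a h false false * S false false + w a h false true * S true false)).
  rewrite /S !mulr_sumr -!big_split /=.
  by apply: eq_bigr => t _; ring.
have wD : w true true true true
    = w true false false true * w false true true false
      - w true false true false * w false true false true.
  by rewrite -wF addrK.
rewrite !{}SE; set P := fun k => _ + _.
case: a; case: h; rewrite /= ?cats0 -?catA /=.
(* Two paths enter: the sign of the 2 x 2 determinant is undone by exchanging [T i] and [E i.+1],
   and [w1111] remains. *)
- rewrite (wN true true true false) // (wN true true false true) //.
  rewrite (wN true true false false) // !mul0r !(add0r, addr0) (recE _ lt_i).
  by rewrite wedge2 wedge_swap wD; ring.
- rewrite (wN true false true true) // (wN true false false false) //.
  by rewrite !mul0r !(add0r, addr0) wedge_linear.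
- rewrite (wN false true true true) // (wN false true false false) //.
  by rewrite !mul0r !(add0r, addr0) (recE _ lt_i) wedge_linear.
- rewrite (wN false false true true) // (wN false false true false) //.
  by rewrite (wN false false false true) // w0 mul1r !mul0r !(add0r, addr0).
Qed.

Lemma row_wedge_tuple (R : comNzRingType) (w : vertex_weight R) n L
    (T E : nat -> 'rV[R]_n) (v : L.-tuple bool) :
  free_fermionic w ->
  (forall k, (k < L)%N ->
     E k = w false true true false *: T k + w false true false true *: E k.+1) ->
  \sum_(v' : L.-tuple bool)
     (row_weight w false false v v' * wedge (occupied T 0 v')
      + row_weight w false true v v' * wedge (E L :: occupied T 0 v'))
  = wedge (occupied (fun k => w true false true false *: T k
                              + w true false false true *: E k.+1) 0 v).
Proof.
case: v => v szv wff; have vL := eqP szv; subst L => recE.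
have := row_wedge false [::] wff recE (add0n _); rewrite cats0 => <-.
by apply: eq_bigr => v' _; rewrite cats0.
Qed.

(** * Partition functions as iterated row sums *)

Fixpoint transfer (R : comNzRingType) L (ws : seq (vertex_weight R))
    (out : bool) (b t : L.-tuple bool) : R :=
  if ws is w :: ws' then
    \sum_(v : L.-tuple bool) row_weight w false out b v * transfer ws' out v t
  else (b == t)%:R.

(** A horizontal state other than [out] past column [L] would persist forever to the right: an
    absent path cannot reappear if nothing comes from below, and a path that cannot leave upwards
    goes on. The first case ([out] true) needs an empty lower edge and is propagated upwards from
    [bottom]; the second needs an empty upper edge and is propagated downwards from [top]. *)
Lemma configs_far k (bottom top : nat -> bool) (out : bool) (L : nat)
    (c : config k) :
  configs bottom top out c ->
  (forall i, (L <= i)%N -> bottom i.+1 = false) ->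
  (forall i, (L <= i)%N -> top i.+1 = false) ->
  forall i, (L <= i)%N ->
    (forall l, vert c i l = false) /\ (forall j, horiz c i j = out).
Proof.
move=> [cons cbot ctop _ [L' cout]] bot0 top0.
have step j : (forall i, (L <= i)%N ->
      if out then below c i j = false else above c i j = false) ->
    forall i, (L <= i)%N ->
      [/\ horiz c i j = out, below c i j = false & above c i j = false].
  move=> H; have hout i : (L <= i)%N -> horiz c i j = out.
    move=> leLi; apply/eqP; apply: contraT => ne.
    have stay n : horiz c (i + n)%N j != out.
      elim: n => [|n IHn]; first by rewrite addn0.
      have := cons (i + n)%N j; rewrite addnS /left /right.
      have leLin : (L <= i + n)%N by lia.
      case: (out) IHn H => IHn /(_ _ leLin) ->; move: IHn.
        by case: (above _ _ _); case: (horiz _ _ _); case: (horiz _ _ _).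
      by case: (below _ _ _); case: (horiz _ _ _); case: (horiz _ _ _).
    by have := stay L'; rewrite (cout _ j (leq_addl _ _)) eqxx.
  move=> i leLi; have := cons i j; rewrite /left /right !hout; try lia.
  case: (out) H => /(_ _ leLi) ->; first by case: (above _ _ _).
  by case: (below _ _ _).
have far (l : 'I_k.+1) i : (L <= i)%N -> vert c i l = false.
  case: (out) step => step leLi.
    have [n lE] : exists n, l = n :> nat by exists l.
    elim: n => [|n IHn] in l lE i leLi *.
      by rewrite (_ : l = ord0) ?cbot ?bot0 //; apply: val_inj.
    have ltnk : (n < k)%N by rewrite -ltnS -lE.
    rewrite (_ : l = lift ord0 (Ordinal ltnk)); last exact: val_inj.
    suff H i' : (L <= i')%N -> below c i' (Ordinal ltnk) = false.
      by have [] := step _ H i leLi.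
    by move=> ?; apply: IHn.
  have [n E] : exists n, (k - l)%N = n by exists (k - l)%N.
  elim: n => [|n IHn] in l E i leLi *.
    rewrite (_ : l = ord_max) ?ctop ?top0 //; apply: val_inj => /=.
    by have := ltn_ord l; lia.
  have ltlk : (l < k)%N by lia.
  rewrite (_ : l = widen_ord (leqnSn k) (Ordinal ltlk)); last exact: val_inj.
  suff H i' : (L <= i')%N -> above c i' (Ordinal ltlk) = false.
    by have [] := step _ H i leLi.
  by move=> ?; apply: IHn => //=; rewrite /bump; lia.
move=> i leLi; split=> [l|j]; first exact: far.
suff H i' : (L <= i')%N ->
    if out then below c i' j = false else above c i' j = false.
  by have [] := step j H i leLi.
by case: (out) => ?; apply: far.
Qed.

Definition row_config (R : comNzRingType) (w : vertex_weight R) L (h0 out : bool)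
    (v v' : seq bool) (h : seq bool) : R :=
  (nth false h 0 == h0)%:R * (nth false h L == out)%:R
  * \prod_(i < L) w (nth false v i) (nth false h i)
                    (nth false v' i) (nth false h i.+1).

Lemma sum_row_config (R : comNzRingType) (w : vertex_weight R) L h0 out
    (v v' : L.-tuple bool) :
  \sum_(h : L.+1.-tuple bool) row_config w L h0 out v v' h
  = row_weight w h0 out v v'.
Proof.
elim: L => [|L IHL] in h0 v v' *.
  rewrite [v]tuple0 [v']tuple0 /= sum_tupleS; under eq_bigr do rewrite sum_tuple0.
  by rewrite big_bool /row_config /= !big_ord0; case: h0; case: out;
    rewrite !(mulr0, mulr1, addr0, add0r).
rewrite sum_tupleS; case/tupleP: v => a v; case/tupleP: v' => b v' /=.
rewrite (bigD1 h0) //= [X in _ + X]big1 ?addr0 => [|h ne_h]; last first.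
  by apply: big1 => t _; rewrite /row_config /= (negbTE ne_h) !mul0r.
rewrite -!IHL !mulr_sumr -big_split /=; apply: eq_bigr => t _.
rewrite /row_config /= eqxx !mul1r !big_ord_recl /=.
case: (nth false t 0) => /=.
  by rewrite !mul0r mulr0 add0r !mul1r mulrCA.
by rewrite !mul0r mulr0 addr0 !mul1r mulrCA.
Qed.

Lemma sum_row_chain (R : comNzRingType) k (w : 'I_k -> vertex_weight R)
    out L (b t : L.-tuple bool) :
  \sum_(V : k.+1.-tuple (L.-tuple bool))
     (tnth V ord0 == b)%:R * (tnth V ord_max == t)%:R
     * \prod_(j < k) row_weight (w j) false out
         (tnth V (widen_ord (leqnSn k) j)) (tnth V (lift ord0 j))
  = transfer [seq w j | j <- enum 'I_k] out b t.
Proof.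
elim: k => [|k IHk] in w b *.
  rewrite (size0nil (size_enum_ord 0)) /= sum_tupleS.
  under eq_bigr do rewrite sum_tuple0 big_ord0 mulr1 !(tnth_nth b) /=.
  rewrite (bigD1 b) //= big1 ?addr0 ?eqxx ?mul1r // => v /negbTE ->.
  by rewrite mul0r.
rewrite enum_ordSl /= -map_comp sum_tupleS (bigD1 b) //=.
rewrite [X in _ + X]big1 ?addr0; last first.
  move=> v /negbTE neb; apply: big1 => V _.
  by rewrite (tnth_nth b) /= neb !mul0r.
under [RHS]eq_bigr do rewrite -IHk mulr_sumr.
rewrite exchange_big /=; apply: eq_bigr => V _.
rewrite (bigD1 (tnth V ord0)) //= [X in _ + X]big1 ?addr0; last first.
  by move=> v /negbTE nev; rewrite eq_sym nev !mul0r mulr0.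
have consS i : tnth [tuple of b :: V] (lift ord0 i) = tnth V i.
  by rewrite !(tnth_nth b).
have widen0 : widen_ord (leqnSn k.+1) ord0 = ord0 by apply: val_inj.
have widenS i : widen_ord (leqnSn k.+1) (lift ord0 i)
    = lift ord0 (widen_ord (leqnSn k) i) by apply: val_inj.
have -> : ord_max = lift ord0 ord_max :> 'I_k.+2 by apply: val_inj.
rewrite big_ord_recl consS widen0 consS [tnth _ ord0](tnth_nth b) /= !eqxx.
rewrite !mul1r mulrCA; congr (_ * (_ * _)).
by apply: eq_bigr => j _; rewrite widenS !consS.
Qed.

(** The default values of [nth] are the only states that [configs_far] allows past the grid. There
    is one more horizontal position than there are columns. *)
Definition grid_config k L (out : bool)
    (p : k.+1.-tuple (L.-tuple bool) * {ffun 'I_k -> L.+1.-tuple bool}) :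
    config k :=
  (fun i l => nth false (tnth p.1 l) i, fun i j => nth out (p.2 j) i).

Lemma grid_config_inj k L out : injective (@grid_config k L out).
Proof.
move=> [V H] [V' H'] [eqV eqH]; congr pair.
  apply: eq_from_tnth => l; apply: eq_from_tnth => i; rewrite !(tnth_nth false).
  by have /(congr1 (fun f => f (val i) l)) := eqV.
apply/ffunP => j; apply: eq_from_tnth => i; rewrite !(tnth_nth out).
by have /(congr1 (fun f => f (val i) j)) := eqH.
Qed.

Lemma grid_config_onto k L bottom top out (c : config k) :
  configs bottom top out c ->
  (forall i, (L <= i)%N -> bottom i.+1 = false) ->
  (forall i, (L <= i)%N -> top i.+1 = false) ->
  exists p, grid_config (L := L) out p = c.
Proof.
move=> cc bot0 top0; have far := configs_far cc bot0 top0.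
exists ([tuple [tuple vert c i l | i < L] | l < k.+1],
        [ffun j => [tuple horiz c i j | i < L.+1]]).
case: c far {cc} => cv ch far; congr pair; apply/funext => i; apply/funext => l /=.
  rewrite tnth_mktuple; case: (ltnP i L) => [lt|le].
    have := tnth_mktuple (fun i : 'I_L => vert (cv, ch) i l) (Ordinal lt).
    by rewrite (tnth_nth false).
  by rewrite nth_default ?size_tuple //; have [/(_ l)] := far i le.
rewrite ffunE; case: (ltnP i L.+1) => [lt|le].
  have := tnth_mktuple (fun i : 'I_L.+1 => horiz (cv, ch) i l) (Ordinal lt).
  by rewrite (tnth_nth out).
by rewrite nth_default ?size_tuple //; have [_ /(_ l)] := far i (ltnW le).
Qed.

Lemma fsum_fin (V : nmodType) (T : finType) (A : set T) (F : T -> V) :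
  \sum_(x \in A) F x = \sum_(x : T | x \in A) F x.
Proof.
rewrite [RHS]bigfs ?index_enum_uniq //; first by rewrite set_mem_set.
by move=> x _; rewrite mem_index_enum.
Qed.

Lemma config_weight_grid (K : fieldType) k (w : 'I_k -> vertex_weight K) out L
    (p : k.+1.-tuple (L.-tuple bool) * {ffun 'I_k -> L.+1.-tuple bool}) :
  (forall j, w j false out false out = 1) ->
  (forall j, nth false (p.2 j) L = out) ->
  config_weight (fun=> w) (grid_config out p)
  = \prod_(j < k) \prod_(i < L)
      w j (nth false (tnth p.1 (widen_ord (leqnSn k) j)) i)
        (nth false (p.2 j) i) (nth false (tnth p.1 (lift ord0 j)) i)
        (nth false (p.2 j) i.+1).
Proof.
move=> wout pL.
rewrite /config_weight.
rewrite (fsbigE [seq (i, j) | j <- enum 'I_k, i <- iota 0 L]) //=.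
- under eq_bigl do rewrite in_setT.
  rewrite big_allpairs_dep /= big_enum /=; apply: eq_bigr => j _.
  rewrite -{1}[L]subn0 -/(index_iota 0 L) big_mkord; apply: eq_bigr => i _.
  rewrite /below /above /left /right /vert /horiz /=.
  by congr (w _ _ _ _ _); apply: set_nth_default; rewrite size_tuple ltnS // ltnW.
- apply: allpairs_uniq; rewrite ?enum_uniq ?iota_uniq //.
  by move=> [? ?] [? ?] _ _ [-> ->].
- move=> [i j] _ /= ij; have [lt|le_i] := ltnP i L.
    by case/negP: ij; apply/allpairsPdep; exists j, i; rewrite mem_enum mem_iota.
  rewrite /below /above /left /right /vert /horiz /=.
  rewrite ![nth false _ i]nth_default ?size_tuple //.
  rewrite [nth _ _ i.+1]nth_default ?size_tuple //.
  (* In column [L] the left edge is still stored in the tuple and equals [out] by [pL]; further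
     right it is the default value. *)
  move: le_i; rewrite leq_eqVlt => /predU1P[<-|lt].
    by rewrite (set_nth_default false) ?size_tuple ?pL.
  by rewrite nth_default ?size_tuple.
Qed.

Lemma partition_function_transfer (K : fieldType) k
    (w : 'I_k -> vertex_weight K) (bottom top : nat -> bool) (out : bool) L :
  (forall j (i1 j1 i2 j2 : bool), (i1 + j1 != i2 + j2)%N ->
     w j i1 j1 i2 j2 = 0) ->
  (forall j, w j false out false out = 1) ->
  (forall i, (L <= i)%N -> bottom i.+1 = false) ->
  (forall i, (L <= i)%N -> top i.+1 = false) ->
  partition_function (fun=> w) bottom top out
  = transfer [seq w j | j <- enum 'I_k] out
      [tuple bottom i.+1 | i < L] [tuple top i.+1 | i < L].
Proof.
move=> wN wout bot0 top0.
pose D := [set p | configs bottom top out (grid_config (k := k) (L := L) out p)]%classic.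
rewrite /partition_function (reindex_fsbig (@grid_config k L out) D); last first.
  split=> [p //|p p' _ _|c cc]; first exact: grid_config_inj.
  have [p pE] := grid_config_onto cc bot0 top0.
  by exists p => //; rewrite /D /= pE.
set b := [tuple bottom _ | _ < _]; set t := [tuple top _ | _ < _].
pose boundary (V : k.+1.-tuple (L.-tuple bool)) : K :=
  (tnth V ord0 == b)%:R * (tnth V ord_max == t)%:R.
rewrite fsum_fin big_mkcond /=.
(* The sum can be extended to all grids: one that is no configuration either breaks a boundary
   condition, and an indicator vanishes, or breaks conservation at a vertex, and its weight
   vanishes. *)
transitivity (\sum_(p : k.+1.-tuple (L.-tuple bool)
                         * {ffun 'I_k -> L.+1.-tuple bool})
   boundary p.1 * \prod_(j < k) row_config (w j) L false out
         (tnth p.1 (widen_ord (leqnSn k) j)) (tnth p.1 (lift ord0 j)) (p.2 j)).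
  apply: eq_bigr => p _; case: ifPn => [|pD].
    move=> /set_mem pD; have far := configs_far pD bot0 top0.
    have pL j : nth false (p.2 j) L = out.
      have [_ /(_ j) <-] := far L (leqnn _).
      by apply: set_nth_default; rewrite size_tuple.
    rewrite config_weight_grid //; case: pD => _ pb pt p0 _.
    have -> : boundary p.1 = 1.
      rewrite /boundary.
      have -> : tnth p.1 ord0 = b.
        by apply: eq_from_tnth => i; rewrite tnth_mktuple -pb (tnth_nth false).
      have -> : tnth p.1 ord_max = t.
        by apply: eq_from_tnth => i; rewrite tnth_mktuple -pt (tnth_nth false).
      by rewrite !eqxx mulr1.
    rewrite mul1r; apply: eq_bigr => j _; rewrite /row_config pL.
    rewrite (_ : nth false (p.2 j) 0 = false) ?eqxx ?mul1r //.
    by rewrite -(p0 j); apply: set_nth_default; rewrite size_tuple.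
  apply/esym/eqP; apply: contraNT pD => wt_neq0; apply: mem_set; move: wt_neq0.
  rewrite /boundary.
  case: (tnth p.1 ord0 =P b) => [Vb|_]; last by rewrite !mul0r eqxx.
  case: (tnth p.1 ord_max =P t) => [Vt|_]; last by rewrite mulr0 mul0r eqxx.
  rewrite !mul1r => /prodf_neq0 row_neq0.
  have row j : [/\ nth false (p.2 j) 0 = false, nth false (p.2 j) L = out
      & forall i : 'I_L, w j (nth false (tnth p.1 (widen_ord (leqnSn k) j)) i)
        (nth false (p.2 j) i) (nth false (tnth p.1 (lift ord0 j)) i)
        (nth false (p.2 j) i.+1) != 0].
    have := row_neq0 j isT; rewrite /row_config.
    case: (nth false (p.2 j) 0 =P false) => [->|_]; last by rewrite !mul0r eqxx.
    case: (nth false (p.2 j) L =P out) => [->|_]; last by rewrite mulr0 mul0r eqxx.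
    by rewrite !mul1r => /prodf_neq0 nz; split=> // i; apply: nz.
  split; rewrite ?/conserving /below /above /left /right /vert /horiz /=.
  - move=> i j; have [lt|le] := ltnP i L.
      have [_ _ /(_ (Ordinal lt)) /=] := row j.
      rewrite -!(set_nth_default false out) ?size_tuple ?ltnS ?(ltnW lt) //.
      by move=> nz; apply/eqP; apply: contraNT nz => /wN ->.
    rewrite ![nth false _ i]nth_default ?size_tuple //.
    rewrite [nth _ _ i.+1]nth_default ?size_tuple //; congr (_ + _)%N.
    move: le; rewrite leq_eqVlt => /predU1P[<-|lt].
      by rewrite (set_nth_default false) ?size_tuple //; have [_ ->] := row j.
    by rewrite nth_default ?size_tuple.
  - move=> i; rewrite Vb; have [lt|le] := ltnP i L.
      by have := tnth_mktuple (fun i : 'I_L => bottom i.+1) (Ordinal lt);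
        rewrite (tnth_nth false).
    by rewrite nth_default ?size_tuple // bot0.
  - move=> i; rewrite Vt; have [lt|le] := ltnP i L.
      by have := tnth_mktuple (fun i : 'I_L => top i.+1) (Ordinal lt);
        rewrite (tnth_nth false).
    by rewrite nth_default ?size_tuple // top0.
  - move=> j; have [<- _ _] := row j.
    by apply: set_nth_default; rewrite size_tuple.
  - by exists L.+1 => i j le; rewrite nth_default ?size_tuple.
rewrite -sum_row_chain.
rewrite -(pair_bigA _ (fun (V : k.+1.-tuple (L.-tuple bool))
    (H : {ffun 'I_k -> L.+1.-tuple bool}) =>
    boundary V * \prod_(j < k) row_config (w j) L false out
         (tnth V (widen_ord (leqnSn k) j)) (tnth V (lift ord0 j)) (H j))) /=.
apply: eq_bigr => V _; rewrite -mulr_sumr; congr (_ * _).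
under eq_bigr do rewrite -sum_row_config.
by rewrite bigA_distr_bigA.
Qed.

(** * Vandermonde determinants *)

Lemma det_scale_rows (R : comNzRingType) n (d : 'I_n -> R) (A : 'M[R]_n) :
  \det (\matrix_(i, j) (d i * A i j)) = (\prod_i d i) * \det A.
Proof.
have -> : \matrix_(i, j) (d i * A i j) = diag_mx (\row_i d i) *m A.
  by apply/matrixP => i j; rewrite mul_diag_mx !mxE.
by rewrite det_mulmx det_diag; under eq_bigr do rewrite mxE.
Qed.

Definition vdm (R : comNzRingType) n (x : 'I_n -> R) : R :=
  \prod_(i < n) \prod_(j < n | (i < j)%N) (x i - x j).

Lemma vdmS (R : comNzRingType) n (x : 'I_n.+1 -> R) :
  vdm x = (\prod_(i < n) (x ord0 - x (lift ord0 i)))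
          * vdm (fun i => x (lift ord0 i)).
Proof.
rewrite /vdm big_ord_recl; congr (_ * _).
  by rewrite big_mkcond big_ord_recl /= mul1r.
by apply: eq_bigr => i _; rewrite big_mkcond big_ord_recl /= mul1r [RHS]big_mkcond.
Qed.

Lemma det_subtract_row0 (R : comNzRingType) n (A : 'M[R]_n.+1) :
  \det (\matrix_(i, j) (if i == ord0 then A i j else A i j - A ord0 j)) = \det A.
Proof.
(* The row operation as a lower unitriangular matrix. *)
pose M : 'M[R]_n.+1 := \matrix_(i, j) ((i == j)%:R - ((i != ord0) && (j == ord0))%:R).
have -> : \matrix_(i, j) (if i == ord0 then A i j else A i j - A ord0 j) = M *m A.
  apply/matrixP => i j; rewrite !mxE.
  under eq_bigr do rewrite mxE mulrBl.
  rewrite sumrB (bigD1 i) //= eqxx mul1r big1 ?addr0 => [|k ne]; last first.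
    by rewrite eq_sym (negbTE ne) mul0r.
  rewrite (bigD1 ord0) //= eqxx andbT [X in _ - (_ + X)]big1 => [|k ne]; last first.
    by rewrite (negbTE ne) andbF mul0r.
  by case: eqP => _; rewrite /= ?mul0r ?mul1r !(addr0, subr0).
rewrite det_mulmx det_trig ?big1 ?mul1r // => [i _|].
  by rewrite mxE eqxx andNb subr0.
apply/is_trig_mxP => i j lt; rewrite mxE.
rewrite (_ : j == ord0 = false) ?andbF ?subr0; last by apply/eqP => j0; rewrite j0 in lt.
by rewrite -val_eqE /= ltn_eqF.
Qed.

(* Subtract the first row, factor [x i - x 0] out of the others and expand. *)
Lemma vdm_dvd_det (R : comNzRingType) n (x : 'I_n -> R) (f : 'I_n -> {poly R}) :
  exists c, \det (\matrix_(i, j) (f j).[x i]) = c * vdm x.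
Proof.
elim: n => [|n IHn] in x f *.
  by exists 1; rewrite det_mx00 /vdm big_ord0 mulr1.
have /boolp.choice[g gE] : forall j, exists q,
    f j - (f j).[x ord0]%:P = q * ('X - (x ord0)%:P).
  by move=> j; apply/factor_theorem; rewrite /root !hornerE subrr.
have /boolp.choice[c cE] : forall j, exists c,
    \det (\matrix_(i, k) (g (lift j k)).[x (lift ord0 i)])
    = c * vdm (fun i => x (lift ord0 i)).
  by move=> j; apply: (IHn _ (fun k => g (lift j k))).
rewrite -det_subtract_row0; set B := \matrix_(i, j) _.
(* The sign [(-1) ^+ n] turns the extracted factors [x i - x 0] into the [x 0 - x i] of [vdm]. *)
exists (\sum_j (f j).[x ord0] * (-1) ^+ j * c j * (-1) ^+ n).
rewrite (expand_det_row B ord0) mulr_suml; apply: eq_bigr => j _.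
rewrite !mxE eqxx /cofactor add0n -!mulrA; congr (_ * (_ * _)).
transitivity (\det (\matrix_(i, k) ((x (lift ord0 i) - x ord0)
    * (\matrix_(i, k) (g (lift j k)).[x (lift ord0 i)]) i k))).
  congr (\det _); apply/matrixP => i k; rewrite !mxE.
  have := congr1 (horner^~ (x (lift ord0 i))) (gE (lift j k)).
  by rewrite !hornerE mulrC.
rewrite det_scale_rows cE vdmS mulrCA; congr (_ * _); rewrite mulrA; congr (_ * _).
rewrite -[X in (-1) ^+ X]card_ord -prodr_const -big_split /=.
by apply: eq_bigr => i _; rewrite mulN1r opprB.
Qed.

Lemma vandermonde_vdm (K : fieldType) n :
  vandermonde K n = vdm (fun i => 'X_i).
Proof. by []. Qed.

Lemma vandermonde_neq0 (K : fieldType) n : vandermonde K n != 0.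
Proof.
apply/prodf_neq0 => i _; apply/prodf_neq0 => j lt_ij.
rewrite subr_eq0; apply/eqP => /(congr1 (mcoeff U_(i))).
rewrite !mcoeffXU eqxx => /eqP; rewrite (_ : j == i = false) ?oner_eq0 //.
by apply/eqP => ji; rewrite ji ltnn in lt_ij.
Qed.

Lemma schurP (K : fieldType) n (lambda : signature n) :
  schur K lambda * vandermonde K n = alternant K lambda.
Proof.
rewrite /schur; case: xgetP => [p _ //|none].
have [c cE] := vdm_dvd_det (fun i => 'X_i : {mpoly K[n]})
  (fun j => 'X^(part lambda j + (n - j.+1))).
case: (none c); rewrite /= vandermonde_vdm -cE.
by congr (\det _); apply/matrixP => i j; rewrite !mxE hornerXn.
Qed.

(** * Signatures and particle configurations *)

Definition positions (v : seq bool) : seq nat := occupied id 0 v.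

Lemma occupied_map (V : Type) (T : nat -> V) i v :
  occupied T i v = [seq T k | k <- occupied id i v].
Proof. by elim: v i => //= b v IHv i; rewrite map_cat IHv; case: b. Qed.

Lemma mem_occupied i v k :
  (k \in occupied id i v) = (i <= k)%N && nth false v (k - i).
Proof.
elim: v i => [|b v IHv] i /=; first by rewrite nth_nil andbF.
rewrite mem_cat IHv; have [lt|lt|->] := ltngtP i k => /=.
- rewrite -[in RHS](subnSK lt) /=.
  by case: b; rewrite ?inE ?(gtn_eqF lt) ?orbF.
- by case: b; rewrite ?inE ?(ltn_eqF lt).
- by rewrite subnn; case: b; rewrite ?inE ?eqxx.
Qed.

Lemma sorted_occupied i v : sorted gtn (occupied id i v).
Proof.
elim: v i => //= b v IHv i; case: b; rewrite ?cats0 //.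
have := IHv i.+1; have := mem_occupied i.+1 v; case: (occupied _ _ _) => //= a s mem_s.
rewrite cat_path => -> /=; rewrite andbT.
have : last a s \in a :: s by apply: mem_last.
by rewrite mem_s => /andP[].
Qed.

Lemma mem_positions v k : (k \in positions v) = nth false v k.
Proof. by rewrite mem_occupied subn0. Qed.

Lemma positions_inj L : injective (fun t : L.-tuple bool => positions t).
Proof.
move=> t t' eq_pos; apply: eq_from_tnth => i.
by rewrite !(tnth_nth false) -!mem_positions eq_pos.
Qed.

Lemma eq_positions v s : sorted gtn s -> (forall k, (k \in s) = nth false v k) ->
  positions v = s.
Proof.
move=> sort_s mem_s.
apply: (irr_sorted_eq (leT := gtn)) => //.
- by move=> a b c /= ? ?; lia.
- by move=> a /=; lia.
- exact: sorted_occupied.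
- by move=> k; rewrite mem_positions mem_s.
Qed.

Definition powers (R : comNzRingType) n (x : 'I_n -> R) (e : nat) : 'rV[R]_n :=
  \row_k x k ^+ e.

(** Since [wedge] is 0 for a wrong number of vectors, sums against [alt] may run over all rows of
    bits, whatever their number of particles. *)
Definition alt (R : comNzRingType) n (x : 'I_n -> R) (v : seq bool) : R :=
  wedge (occupied (powers x) 0 v).

Lemma wedge_occupied (R : comNzRingType) n (T : nat -> 'rV[R]_n) v :
  size (positions v) = n ->
  wedge (occupied T 0 v)
  = \det (\matrix_(k, j) T (nth 0%N (positions v) j) 0 k).
Proof.
move=> szv; rewrite /wedge occupied_map size_map szv eqxx -det_tr.
congr (\det _); apply/matrixP => i j.
by rewrite !mxE (nth_map 0%N) // [size _]szv.
Qed.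

Lemma wedge_occupied_eq0 (R : comNzRingType) n (T : nat -> 'rV[R]_n) v :
  size (positions v) != n -> wedge (occupied T 0 v) = 0.
Proof. by move=> szv; rewrite /wedge occupied_map size_map (negbTE szv). Qed.

Lemma alt_det (R : comNzRingType) n (x : 'I_n -> R) v : size (positions v) = n ->
  alt x v = \det (\matrix_(i, j) x i ^+ nth 0%N (positions v) j).
Proof.
move=> szv; rewrite /alt wedge_occupied //; congr (\det _).
by apply/matrixP => i j; rewrite !mxE.
Qed.

Lemma alt_eq0 (R : comNzRingType) n (x : 'I_n -> R) v :
  size (positions v) != n -> alt x v = 0.
Proof. exact: wedge_occupied_eq0. Qed.

Lemma vdm_dvd_alt (R : comNzRingType) n (x : 'I_n -> R) v :
  exists c, c * vdm x = alt x v.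
Proof.
have [szv|] := eqVneq (size (positions v)) n; last first.
  by exists 0; rewrite mul0r alt_eq0.
have [c cE] := vdm_dvd_det x (fun j => 'X^(nth 0%N (positions v) j)).
exists c; rewrite -cE alt_det //; congr (\det _).
by apply/matrixP => i j; rewrite !mxE hornerXn.
Qed.

Lemma part_le N (lambda : signature N) (i j : 'I_N) :
  (i <= j)%N -> (part lambda j <= part lambda i)%N.
Proof.
rewrite /part !(tnth_nth 0%N).
have geq_trans : transitive geq by move=> a b c /= ? ?; lia.
have geq_refl : reflexive geq by move=> a /=.
move=> le_ij; apply: (sorted_leq_nth geq_trans geq_refl 0%N (valP lambda)) => //;
by rewrite inE size_tuple.
Qed.

(** Counting columns from 0 turns the particle positions into exactly the exponents of
    [alternant]. *)
Definition columns N (lambda : signature N) : seq nat :=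
  [seq (part lambda j + (N - j.+1))%N | j <- enum 'I_N].

Definition bits N (lambda : signature N) L : L.-tuple bool :=
  [tuple particles lambda i.+1 | i < L].

Lemma particlesS N (lambda : signature N) i :
  particles lambda i.+1 = (i \in columns lambda).
Proof.
apply/existsP/mapP => [[j /eqP jE]|[j _ ->]]; exists j; rewrite ?mem_enum //.
  by have := ltn_ord j; lia.
by apply/eqP; have := ltn_ord j; lia.
Qed.

Lemma positions_bits N (lambda : signature N) L :
  (forall j : 'I_N, part lambda j + (N - j.+1) < L)%N ->
  positions (bits lambda L) = columns lambda.
Proof.
move=> ltL; apply: eq_positions => [|k].
  rewrite sorted_map; apply: (@sub_sorted _ (relpre val ltn)).
    move=> i j /= lt_ij; have := part_le lambda (ltnW lt_ij).
    by have := ltn_ord j; lia.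
  by rewrite -sorted_map val_enum_ord iota_ltn_sorted.
have [lt|le] := ltnP k L.
  have := tnth_mktuple (fun i : 'I_L => particles lambda i.+1) (Ordinal lt).
  by rewrite (tnth_nth false) particlesS /= => ->.
rewrite nth_default ?size_tuple //; apply/mapP => -[j _ kE].
by have := ltL j; lia.
Qed.

Lemma size_columns N (lambda : signature N) : size (columns lambda) = N.
Proof. by rewrite size_map size_enum_ord. Qed.

Lemma nth_columns N (lambda : signature N) (j : 'I_N) :
  nth 0%N (columns lambda) j = (part lambda j + (N - j.+1))%N.
Proof. by rewrite (nth_map j) ?size_enum_ord // nth_ord_enum. Qed.

Lemma alternant_alt (K : fieldType) N (lambda : signature N) L :
  (forall j : 'I_N, part lambda j + (N - j.+1) < L)%N ->
  alternant K lambda = alt (fun i => 'X_i) (bits lambda L).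
Proof.
move=> ltL; rewrite alt_det positions_bits ?size_columns //.
by congr (\det _); apply/matrixP => i j; rewrite !mxE nth_columns.
Qed.

Lemma signature_of_positions N L (t : L.-tuple bool) :
  size (positions t) = N ->
  exists lambda : signature N,
    (forall j : 'I_N, part lambda j + (N - j.+1) < L)%N /\ bits lambda L = t.
Proof.
move=> szt.
(* Strictly decreasing positions drop by at least one per step, so subtracting the staircase leaves
   a weakly decreasing sequence; with [gap0] the subtraction in [nat] loses nothing. *)
have gap (i j : nat) : (i <= j < N)%N ->
    (nth 0 (positions t) j + (j - i) <= nth 0 (positions t) i)%N.
  elim: j => [|j IHj]; first by rewrite leqn0 => /andP[/eqP ->]; rewrite addn0.
  move=> /andP[le lt]; move: le; rewrite leq_eqVlt => /predU1P[->|le].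
    by rewrite subnn addn0.
  have := sorted_occupied 0 t => /(sortedP 0%N)/(_ j); rewrite [size _]szt => /(_ lt).
  by rewrite /= => lt_nth; have := IHj; rewrite -/(positions t) in lt_nth *; lia.
have gap0 (j : 'I_N) : (N - j.+1 <= nth 0 (positions t) j)%N.
  have := gap j N.-1; have := ltn_ord j; lia.
pose l := [tuple (nth 0 (positions t) j - (N - j.+1))%N | j < N].
have sl : sorted geq l.
  apply/(sortedP 0%N) => i; rewrite size_tuple => lt.
  pose f (j : 'I_N) := (nth 0 (positions t) j - (N - j.+1))%N.
  have := tnth_mktuple f (Ordinal lt).
  have := tnth_mktuple f (Ordinal (ltnW lt)).
  rewrite /f !(tnth_nth 0%N) /= => -> ->.
  by have := gap i i.+1; have := gap0 (Ordinal lt); rewrite /=; lia.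
exists (exist _ l sl).
have partE (j : 'I_N) : part (exist _ l sl) j = (nth 0 (positions t) j - (N - j.+1))%N.
  by rewrite /part tnth_mktuple.
have ltL (j : 'I_N) : (part (exist _ l sl) j + (N - j.+1) < L)%N.
  rewrite partE subnK //.
  have : nth 0 (positions t) j \in positions t by rewrite mem_nth // szt.
  rewrite mem_positions; apply: contraTltn => le.
  by rewrite nth_default // size_tuple.
split=> //; apply: positions_inj; rewrite positions_bits //.
apply: (@eq_from_nth _ 0%N); rewrite size_columns ?szt // => i lt.
by apply: etrans (nth_columns _ (Ordinal lt)) _; rewrite partE subnK //.
Qed.

Lemma bits_inj N (lambda mu : signature N) L :
  (forall j : 'I_N, part lambda j + (N - j.+1) < L)%N ->
  (forall j : 'I_N, part mu j + (N - j.+1) < L)%N ->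
  bits lambda L = bits mu L -> lambda = mu.
Proof.
move=> ltl ltm /(congr1 (fun t : L.-tuple bool => positions t)).
rewrite !positions_bits // => eq_columns; apply: val_inj; apply: eq_from_tnth => j.
have := congr1 (fun s => nth 0%N s j) eq_columns; rewrite /= !nth_columns.
by move/addIn.
Qed.

(** * A row with an exiting path *)

(** The recursion of [row_wedge] is solved backwards from a free final value [e]: a new basis vector
    to detect the exiting path, or 0 to suppress it. *)
Lemma exists_carry (R : comNzRingType) n L (T : nat -> 'rV[R]_n) a c e :
  exists E : nat -> 'rV[R]_n,
    E L = e /\ forall k, (k < L)%N -> E k = c *: T k + a *: E k.+1.
Proof.
pose D := fix D d := if d is d'.+1 then c *: T (L - d)%N + a *: D d' else e.
exists (fun k => D (L - k)%N); split=> [|k lt]; first by rewrite subnn.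
by rewrite -(subnSK lt) /= subnSK // subKn // ltnW.
Qed.

Lemma descending_ind L (P : nat -> Prop) : P L ->
  (forall k, (k < L)%N -> P k.+1 -> P k) -> forall k, (k <= L)%N -> P k.
Proof.
move=> PL step k le; rewrite -(subKn le); elim: (L - k)%N (leq_subr k L) => [|d IHd] led.
  by rewrite subn0.
by apply: step; [lia|rewrite subnSK //; apply: IHd; lia].
Qed.

Definition ord_cons (T : Type) n (u : T) (x : 'I_n -> T) (i : 'I_n.+1) : T :=
  if unlift ord0 i is Some j then x j else u.

Lemma ord_cons0 (T : Type) n (u : T) (x : 'I_n -> T) : ord_cons u x ord0 = u.
Proof. by rewrite /ord_cons unlift_none. Qed.

Lemma ord_consS (T : Type) n (u : T) (x : 'I_n -> T) j :
  ord_cons u x (lift ord0 j) = x j.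
Proof. by rewrite /ord_cons liftK. Qed.

Lemma det_col0 (R : comNzRingType) n (A : 'M[R]_n.+1) :
  (forall i, A (lift ord0 i) ord0 = 0) ->
  \det A = A ord0 ord0 * \det (\matrix_(i, j) A (lift ord0 i) (lift ord0 j)).
Proof.
move=> A0; rewrite (expand_det_col A ord0) big_ord_recl big1 ?addr0 => [|i _].
  rewrite /cofactor expr0 mul1r; congr (_ * \det _).
  by apply/matrixP => i j; rewrite !mxE.
by rewrite A0 mul0r.
Qed.

(* The extra row [u = 1 / w 0 1 0 1] of the alternant records the path that
   leaves to the right. *)
Lemma exiting_row_alt (R : comNzRingType) (w : vertex_weight R) n L
    (x : 'I_n -> R) (u : R) (v : L.-tuple bool) :
  free_fermionic w -> u * w false true false true = 1 ->
  (\prod_k (1 - w false true false true * x k))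
    * (u ^+ L * \sum_(v' : L.-tuple bool) row_weight w false true v v' * alt x v')
  = u * w true false false true
    * (\prod_k (w true false true false + w true true true true * x k))
    * alt (ord_cons u x) v.
Proof.
move=> wff; have [_ _ wF] := wff.
set a := w false true false true in wF *.
set be := w true false true false in wF *.
set a2 := w true true true true in wF *.
set c1 := w true false false true in wF *.
set c2 := w false true true false in wF *.
move=> ua.
(* Coordinate 0 vanishes on every [T i] and [E L] is its basis vector. Hence terms without an
   exiting path vanish, and the others lose one dimension and become [alt x v']. *)
pose T i : 'rV[R]_n.+1 := \row_k ord_cons 0 (fun j => x j ^+ i) k.
have [E [EL recE]] := exists_carry L T a c2 (delta_mx 0 ord0).
have E0 k : (k <= L)%N -> E k 0 ord0 = a ^+ (L - k).
  move: k; apply: descending_ind => [|k lt Ek]; first by rewrite EL mxE !eqxx subnn.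
  by rewrite recE // !mxE Ek ord_cons0 mulr0 add0r -exprS subnSK.
(* A finite geometric sum, with its denominator cleared. *)
have EK j k : (k <= L)%N ->
    (1 - a * x j) * E k 0 (lift ord0 j) = c2 * (x j ^+ k - a ^+ (L - k) * x j ^+ L).
  move: k; apply: descending_ind => [|k lt Ek].
    by rewrite EL mxE subnn eqxx (_ : _ == _ = false) // mulr0 mul1r subrr mulr0.
  rewrite recE // !mxE ord_consS mulrDr mulrCA [X in _ + X]mulrCA Ek.
  by rewrite -(subnSK lt) !exprS; ring.
have -> : \sum_(v' : L.-tuple bool) row_weight w false true v v' * alt x v'
  = wedge (occupied (fun k => be *: T k + c1 *: E k.+1) 0 v).
  rewrite -(row_wedge_tuple _ wff recE); apply: eq_bigr => v' _.
  have -> : wedge (occupied T 0 v') = 0.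
    have [szv|] := eqVneq (size (positions v')) n.+1; last exact: wedge_occupied_eq0.
    rewrite wedge_occupied // (expand_det_row _ ord0) big1 // => j _.
    by rewrite !mxE ord_cons0 mul0r.
  rewrite mulr0 add0r EL; congr (_ * _).
  rewrite /alt /wedge /= eqSS (occupied_map T) (occupied_map (powers x)).
  rewrite !size_map; case: eqP => // szv.
  rewrite [RHS]det_col0 => [|i]; last first.
    by rewrite mxE lift0 /= (nth_map 0%N) ?szv // mxE ord_cons0.
  rewrite [X in _ = X * _]mxE [X in _ = X * _]mxE !eqxx mul1r; congr (\det _).
  apply/matrixP => i j; rewrite !mxE lift0 /=.
  by rewrite !(nth_map 0%N) ?szv // !mxE ord_consS.
have [szv|szv] := eqVneq (size (positions v)) n.+1; last first.
  by rewrite wedge_occupied_eq0 // alt_eq0 // !mulr0.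
rewrite alt_det // wedge_occupied //.
set B := \matrix_(k, j) _; set A := \matrix_(i, j) _.
(* [M] clears the denominators [1 - a * x k] and adds a multiple of row 0 to each other row,
   cancelling the tail [a ^+ (L - k) * x j ^+ L] of the geometric sum in [EK]. *)
pose M : 'M[R]_n.+1 := \matrix_(i, j)
  ((i == j)%:R * ord_cons (u ^+ L) (fun k => 1 - a * x k) i
  + (j == ord0)%:R * ord_cons 0 (fun k => c2 * x k ^+ L) i).
have detM : \det M = u ^+ L * \prod_k (1 - a * x k).
  rewrite det_trig.
    rewrite big_ord_recl !mxE eqxx !ord_cons0 mulr0 addr0 mul1r; congr (_ * _).
    by apply: eq_bigr => k _; rewrite !mxE eqxx !ord_consS mul1r mul0r addr0.
  apply/is_trig_mxP => i j lt; rewrite mxE -val_eqE ltn_eqF //.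
  by rewrite (_ : j == ord0 = false) ?mul0r ?addr0 //; apply/eqP => j0; rewrite j0 in lt.
rewrite mulrA (mulrC (\prod_k _)) -detM -det_mulmx.
rewrite -mulrA -mulrA mulrA.
have -> : u * c1 * ((\prod_k (be + a2 * x k)) * \det A)
  = (\prod_i ord_cons (u * c1) (fun k => be + a2 * x k) i) * \det A.
  by rewrite big_ord_recl ord_cons0 -!mulrA; under [in RHS]eq_bigr do rewrite ord_consS.
rewrite -det_scale_rows; congr (\det _); apply/matrixP => i j; rewrite !mxE.
set p := nth _ _ _.
have lt_p : (p < L)%N.
  have : p \in positions v by rewrite mem_nth // szv.
  rewrite mem_positions; apply: contraTltn => le.
  by rewrite nth_default // size_tuple.
transitivity (ord_cons (u ^+ L) (fun k => 1 - a * x k) i * B i j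
    + ord_cons 0 (fun k => c2 * x k ^+ L) i * B ord0 j).
  under eq_bigr do rewrite mxE mulrDl.
  rewrite big_split /=; congr (_ + _).
    rewrite (bigD1 i) //= eqxx mul1r big1 ?addr0 // => k ne.
    by rewrite eq_sym (negbTE ne) !mul0r.
  rewrite (bigD1 ord0) //= mul1r big1 ?addr0 // => k ne.
  by rewrite (negbTE ne) !mul0r.
have B0 : B ord0 j = c1 * a ^+ (L - p.+1).
  by rewrite !mxE -/p ord_cons0 mulr0 add0r E0.
rewrite B0; case: (unliftP ord0 i) => [k|] ->; last first.
  rewrite !ord_cons0 mul0r addr0 B0 -[in u ^+ L](subnKC lt_p) exprD.
  by rewrite -mulrA [u ^+ (_ - _) * _]mulrCA -exprMn ua expr1n mulr1 exprS; ring.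
rewrite !ord_consS mxE !mxE -/p ord_consS mulrDr [X in _ + X + _]mulrCA EK // exprS.
transitivity ((be + (c1 * c2 - be * a) * x k) * x k ^+ p); first by ring.
by rewrite -wF addrK.
Qed.

(** * The function F *)

Lemma row_weight_map (R S : comNzRingType) (f : {rmorphism R -> S})
    (w : vertex_weight R) h out v v' :
  row_weight (fun a b c d => f (w a b c d)) h out v v'
  = f (row_weight w h out v v').
Proof.
elim: v h v' => [|a v IHv] h [|b v'] //=; rewrite ?rmorph0 ?rmorph_nat //.
by rewrite !IHv rmorphD !rmorphM.
Qed.

Lemma free_fermionic_map (R S : comNzRingType) (f : {rmorphism R -> S})
    (w : vertex_weight R) :
  free_fermionic w -> free_fermionic (fun a b c d => f (w a b c d)).
Proof.
case=> w0 wN wF; split; first by rewrite w0 rmorph1.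
- by move=> *; rewrite wN ?rmorph0.
- by rewrite -!rmorphM -rmorphD wF.
Qed.

Lemma row_weight_scale (R : comNzRingType) (u : R) (w : vertex_weight R)
    h out v v' :
  row_weight (fun a b c d => u * w a b c d) h out v v'
  = u ^+ size v * row_weight w h out v v'.
Proof.
elim: v h v' => [|a v IHv] h [|b v'] //=; rewrite ?mulr0 ?mul1r //.
by rewrite !IHv exprS; ring.
Qed.

Lemma alt_map (R S : comNzRingType) (f : {rmorphism R -> S}) n (x : 'I_n -> R) v :
  f (alt x v) = alt (fun i => f (x i)) v.
Proof.
have [szv|szv] := eqVneq (size (positions v)) n; last first.
  by rewrite !alt_eq0 // rmorph0.
rewrite !alt_det // -det_map_mx; congr (\det _); apply/matrixP => i j.
by rewrite !mxE rmorphXn.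
Qed.

Lemma vdm_map (R S : comNzRingType) (f : {rmorphism R -> S}) n (x : 'I_n -> R) :
  f (vdm x) = vdm (fun i => f (x i)).
Proof.
rewrite /vdm rmorph_prod; apply: eq_bigr => i _.
by rewrite rmorph_prod; apply: eq_bigr => j _; rewrite rmorphB.
Qed.

Lemma vdm_reflect (R : comNzRingType) n (x : 'I_n -> R) :
  \prod_(i < n) \prod_(j < n | (i < j)%N) (x (rev_ord j) - x (rev_ord i)) = vdm x.
Proof.
rewrite (reindex_inj rev_ord_inj) /=.
under eq_bigr => i _.
  rewrite (reindex_inj rev_ord_inj) /=.
  rewrite (eq_bigl (fun j : 'I_n => (j < i)%N)) => [|j]; last first.
    by have := ltn_ord i; have := ltn_ord j; rewrite /=; lia.
  under eq_bigr do rewrite !rev_ordK.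
  over.
by rewrite (exchange_big_dep predT).
Qed.

(** [Vandermonde] has increasing exponents and the opposite differences. Reversing both its rows and
    its columns applies the same permutation twice, so the signs cancel. *)
Lemma det_powers (R : comNzRingType) n (x : 'I_n -> R) :
  \det (\matrix_(i, j) x i ^+ (n - j.+1)) = vdm x.
Proof.
rewrite -vdm_reflect.
have -> : \prod_(i < n) \prod_(j < n | (i < j)%N) (x (rev_ord j) - x (rev_ord i))
    = \det (Vandermonde n (\row_j x (rev_ord j))).
  rewrite det_Vandermonde; apply: eq_bigr => i _; apply: eq_bigr => j _.
  by rewrite !mxE.
pose s := perm (@rev_ord_inj n).
have -> : Vandermonde n (\row_j x (rev_ord j))
    = row_perm s (col_perm s (\matrix_(i, j) x i ^+ (n - j.+1))^T).
  apply/matrixP => i j; rewrite !mxE !permE /=; congr (_ ^+ _).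
  by have := ltn_ord i; lia.
rewrite row_permE col_permE !det_mulmx !det_perm det_tr odd_permV.
by rewrite mulrCA -signr_addb addbb mulr1.
Qed.

Lemma alternant_signature0 (K : fieldType) N :
  alternant K (signature0 N) = vandermonde K N.
Proof.
rewrite vandermonde_vdm -det_powers; congr (\det _); apply/matrixP => i j.
by rewrite !mxE /part /= (tnth_nth 0%N) nth_nseq ltn_ord.
Qed.

Lemma schur_signature0 (K : fieldType) N : schur K (signature0 N) = 1.
Proof.
apply: (mulIf (vandermonde_neq0 K N)).
by rewrite schurP alternant_signature0 mul1r.
Qed.

Lemma positions_nseq0 L : positions (nseq L false) = [::].
Proof. by apply: eq_positions => // k; rewrite nth_nseq if_same. Qed.

(** The point is that [C] is chosen before [v]. Working with the quotient [S] rather than with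
    alternants at [u] covers coinciding values [u j]. *)
Lemma transfer_exit (K : fieldType) n L (w : 'I_n -> vertex_weight K)
    (u : 'I_n -> K) :
  (forall j, free_fermionic (w j)) ->
  (forall j, u j * w j false true false true = 1) ->
  exists C, forall (v : L.-tuple bool) (S : {mpoly K[n]}),
    S * vandermonde K n = alt (fun i => 'X_i) v ->
    transfer [seq (fun a b c d => u j * w j a b c d) | j <- enum 'I_n] true v
      [tuple of nseq L false] = C * S.@[u].
Proof.
elim: n => [|n IHn] in w u *.
  move=> _ _; exists 1 => v S; rewrite vandermonde_vdm /vdm big_ord0 mulr1 => ->.
  rewrite (size0nil (size_enum_ord 0)) /= mul1r; case: eqP => [->|ne].
    by rewrite alt_det ?det_mx00 ?rmorph1 //= positions_nseq0.
  rewrite alt_eq0 ?rmorph0 //; apply: contra_notN ne => /nilP v0.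
  by apply: positions_inj; rewrite v0 positions_nseq0.
move=> wff ua.
have [C' C'E] := IHn (fun j => w (lift ord0 j)) (fun j => u (lift ord0 j))
  (fun j => wff _) (fun j => ua _).
set u0 := u ord0; set w0 := w ord0; set u' := fun j => u (lift ord0 j).
have /boolp.choice[S' S'E] := vdm_dvd_alt (fun i => 'X_i : {mpoly K[n]}).
(* One [u0] comes from [exiting_row_alt] and [n] from [vdm_xs]; the other new factors are those of
   [exiting_row_alt], evaluated at [u']. *)
exists (C' * (u0 ^+ n.+1 * w0 true false false true
   * \prod_k (w0 true false true false + w0 true true true true * u' k))).
move=> v S SE.
rewrite enum_ordSl /= -map_comp.
pose xs : 'I_n.+1 -> {mpoly K[n]} := ord_cons u0%:MP (fun i => 'X_i).
(* The bottom row fixes the variable 0 at [u0]; the other variables stay free for the rows above. *)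
pose So := S \mPo [tuple xs i | i < n.+1].
have evalS : So.@[u'] = S.@[u].
  rewrite comp_mpoly_meval; apply: meval_eq => i; rewrite tnth_mktuple /xs.
  by case: (unliftP ord0 i) => [j|] ->; rewrite ?ord_consS ?ord_cons0 ?mevalXU ?mevalC.
have SoE : So * vdm xs = alt xs v.
  have := congr1 (comp_mpoly [tuple xs i | i < n.+1]) SE.
  rewrite rmorphM /= vandermonde_vdm vdm_map alt_map /=.
  have -> : (fun i => 'X_i \mPo [tuple xs i | i < n.+1]) = xs.
    by apply/funext => i; rewrite comp_mpolyXU -tnth_nth tnth_mktuple.
  by [].
pose wR a b c d := (w0 a b c d)%:MP : {mpoly K[n]}.
pose D := \prod_(k < n) (1 - wR false true false true * 'X_k).
have D_neq0 : D != 0.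
  apply/prodf_neq0 => k _; apply/eqP => /(congr1 (meval (fun=> 0))) /eqP.
  rewrite rmorphB rmorphM /= rmorph1 mevalC mevalXU mulr0 subr0 meval0.
  by rewrite oner_eq0.
have vdm_neq0 := vandermonde_neq0 K n; rewrite vandermonde_vdm in vdm_neq0.
have uaR : u0%:MP * wR false true false true = 1.
  by rewrite /wR -rmorphM ua rmorph1.
(* As [u0 - X_k = u0 * (1 - a X_k)], the differences with the new variable supply the factor [D] of
   [exiting_row_alt], which then cancels. *)
have vdm_xs : vdm xs = u0%:MP ^+ n * D * vdm (fun i : 'I_n => 'X_i : {mpoly K[n]}).
  rewrite vdmS /xs ord_cons0; congr (_ * _).
    rewrite -[X in _ ^+ X]card_ord -prodr_const -big_split /=.
    apply: eq_bigr => k _; rewrite ord_consS mulrBr mulr1.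
    by rewrite mulrA uaR mul1r.
  by congr vdm; apply/funext => i; rewrite ord_consS.
pose Q := u0%:MP ^+ L * \sum_(v' : L.-tuple bool)
  (row_weight w0 false true v v')%:MP * S' v' : {mpoly K[n]}.
have QE : Q = u0%:MP ^+ n.+1 * wR true false false true
    * (\prod_k (wR true false true false + wR true true true true * 'X_k)) * So.
  apply: (mulfI D_neq0); apply: (mulIf vdm_neq0).
  have := @exiting_row_alt _ wR n L (fun i => 'X_i) u0%:MP v
    (free_fermionic_map (@mpolyC n K) (wff ord0)) uaR.
  rewrite -SoE vdm_xs -/D /Q => H; rewrite -!mulrA.
  have -> : (\sum_(v' : L.-tuple bool) (row_weight w0 false true v v')%:MP * S' v')
      * vdm (fun i => 'X_i)
    = \sum_(v' : L.-tuple bool) row_weight wR false true v v' * alt (fun i => 'X_i) v'.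
    rewrite mulr_suml; apply: eq_bigr => v' _.
    by rewrite -mulrA S'E -row_weight_map.
  by rewrite {}H exprS; ring.
transitivity (C' * Q.@[u']); last first.
  have -> : Q.@[u'] = u0 ^+ n.+1 * w0 true false false true
      * (\prod_k (w0 true false true false + w0 true true true true * u' k)) * S.@[u].
    rewrite QE !rmorphM rmorphXn rmorph_prod /= evalS !mevalC.
    by under eq_bigr do rewrite rmorphD rmorphM /= !mevalC mevalXU.
  by rewrite mulrA.
rewrite /Q rmorphM rmorphXn rmorph_sum /= mevalC !mulr_sumr; apply: eq_bigr => v' _.
rewrite row_weight_scale size_tuple rmorphM /= mevalC.
rewrite (C'E v' (S' v')) ?S'E //.
by rewrite -/u0 -/w0 -/u'; ring.
Qed.

Definition column_bound N (lambda : signature N) : nat := (N + \sum_j part lambda j)%N.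

Lemma lt_column_bound N (lambda : signature N) (j : 'I_N) :
  (part lambda j + (N - j.+1) < column_bound lambda)%N.
Proof.
by rewrite /column_bound (bigD1 j) //=; have := ltn_ord j; lia.
Qed.

Lemma particles_far N (lambda : signature N) L :
  (forall j : 'I_N, part lambda j + (N - j.+1) < L)%N ->
  forall i, (L <= i)%N -> particles lambda i.+1 = false.
Proof.
move=> ltL i le; rewrite particlesS; apply/mapP => -[j _ iE].
by have := ltL j; lia.
Qed.

Lemma weight_denom_neq0 (K : fieldType) (x s : K) :
  s != 0 -> 1 - s ^+ 2 * x != 0 -> s ^- 2 * 1 - x != 0.
Proof.
move=> s0; apply: contraNneq => /eqP; rewrite mulr1 subr_eq0 => /eqP <-.
by rewrite divff ?subrr // expf_neq0.
Qed.

Lemma weight_free_fermionic (K : fieldType) (x r s : K) :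
  s != 0 -> r != 0 -> 1 - s ^+ 2 * x != 0 -> free_fermionic (weight x 1 r s).
Proof.
move=> s0 r0 xs; have := weight_denom_neq0 s0 xs => den.
split=> //=; first exact: weight_nonconserving.
by field; rewrite r0 s0 mulNr mulrC xs.
Qed.

Lemma F_schur (K : fieldType) (s : K) (N : nat) (lambda : signature N)
    (x r : 'I_N -> K) :
  s != 0 -> (forall j, r j != 0) -> (forall j, 1 - s ^+ 2 * x j != 0) ->
  (forall j, 1 - x j != 0) ->
  F (signature0 N) x (fun=> 1) r (fun=> s) != 0 ->
  F lambda x (fun=> 1) r (fun=> s) / F (signature0 N) x (fun=> 1) r (fun=> s)
  = schur_eval lambda (fun j => (1 - s ^+ 2 * x j) / (s ^+ 2 * (1 - x j))).
Proof.
move=> s0 r0 xs x1.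
set u := fun j => _ / _.
pose w j := weight (x j) 1 (r j) s.
(* The same [u j] is the normalisation of [weight_hat] and the variable added by an exiting row. *)
have ua j : u j * w j false true false true = 1.
  rewrite /u /w /=;
  by field; rewrite s0 x1 mulNr mulrC xs.
have wff j : free_fermionic (w j) by exact: weight_free_fermionic.
(* This width also holds the columns of the zero signature, so numerator and denominator share one
   [C]. *)
have [C CE] := transfer_exit (column_bound lambda) wff ua.
have FE (mu : signature N) :
    (forall j : 'I_N, part mu j + (N - j.+1) < column_bound lambda)%N ->
    F mu x (fun=> 1) r (fun=> s) = C * schur_eval mu u.
  move=> lt_mu; rewrite /schur_eval -(CE (bits mu (column_bound lambda))); last first.
    by rewrite schurP; apply: alternant_alt.
  have hatE : (fun j => weight_hat (x j) 1 (r j) s)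
      = (fun j a b c d => u j * w j a b c d).
    apply/funext => j; apply/funext => a; apply/funext => b; apply/funext => c.
    apply/funext => d; rewrite /weight_hat mulrC; congr (_ * _).
    by apply: mulr1_eq; rewrite mulrC; apply: ua.
  rewrite /F hatE (partition_function_transfer (L := column_bound lambda)) //.
  - congr transfer; apply: eq_from_tnth => i.
    by rewrite tnth_mktuple (tnth_nth false) nth_nseq ltn_ord.
  - by move=> j a b c d ne; rewrite /w weight_nonconserving ?mulr0.
  - exact: particles_far.
rewrite !FE; last 2 first.
- exact: lt_column_bound.
- move=> j; rewrite /part /= (tnth_nth 0%N) nth_nseq ltn_ord /column_bound.
  by have := ltn_ord j; lia.
rewrite /schur_eval schur_signature0 rmorph1 mulr1 => C0.
by rewrite mulrAC divff ?mul1r.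
Qed.

(** * Rows without exiting paths *)

(** Stands for equality of power series up to terms of degree at least [D]. *)
Definition eqmod (R : comNzRingType) n D (p q : {mpoly R[n]}) : Prop :=
  forall m : 'X_{1..n}, (mdeg m < D)%N -> p@_m = q@_m.

Lemma eqmod_trans (R : comNzRingType) n D (p q r : {mpoly R[n]}) :
  eqmod D p q -> eqmod D q r -> eqmod D p r.
Proof. by move=> pq qr m lt; rewrite pq // qr. Qed.

Lemma eqmodD (R : comNzRingType) n D (p p' q q' : {mpoly R[n]}) :
  eqmod D p p' -> eqmod D q q' -> eqmod D (p + q) (p' + q').
Proof. by move=> pp qq m lt; rewrite !mcoeffD pp // qq. Qed.

Lemma eqmodM (R : comNzRingType) n D (p p' q q' : {mpoly R[n]}) :
  eqmod D p p' -> eqmod D q q' -> eqmod D (p * q) (p' * q').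
Proof.
move=> pp qq m lt; rewrite !mcoeffM; apply: eq_bigr => k /eqP mk.
have lt12 : (mdeg k.1 + mdeg k.2 < D)%N by rewrite -mdegD -mk.
rewrite pp ?qq //.
  exact: leq_ltn_trans (leq_addl _ _) lt12.
exact: leq_ltn_trans (leq_addr _ _) lt12.
Qed.

Lemma eqmod_sum (R : comNzRingType) n D (I : Type) (r : seq I) (P : pred I)
    (F F' : I -> {mpoly R[n]}) :
  (forall i, P i -> eqmod D (F i) (F' i)) ->
  eqmod D (\sum_(i <- r | P i) F i) (\sum_(i <- r | P i) F' i).
Proof. by move=> FF; elim/big_rec2: _ => // i p q Pi; apply/eqmodD/FF. Qed.

Lemma eqmod_prod (R : comNzRingType) n D (I : Type) (r : seq I) (P : pred I)
    (F F' : I -> {mpoly R[n]}) :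
  (forall i, P i -> eqmod D (F i) (F' i)) ->
  eqmod D (\prod_(i <- r | P i) F i) (\prod_(i <- r | P i) F' i).
Proof. by move=> FF; elim/big_rec2: _ => // i p q Pi; apply/eqmodM/FF. Qed.

Lemma eqmod_det (R : comNzRingType) n D k (A B : 'M[{mpoly R[n]}]_k) :
  (forall i j, eqmod D (A i j) (B i j)) -> eqmod D (\det A) (\det B).
Proof.
move=> AB; apply: eqmod_sum => s _; apply: eqmodM => //.
by apply: eqmod_prod => i _.
Qed.

Lemma eqmod_refl (R : comNzRingType) n D (p : {mpoly R[n]}) : eqmod D p p.
Proof. by []. Qed.

Lemma eqmod_sym (R : comNzRingType) n D (p q : {mpoly R[n]}) :
  eqmod D p q -> eqmod D q p.
Proof. by move=> pq m lt; rewrite pq. Qed.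

Lemma eqmodMl (R : comNzRingType) n D (r p q : {mpoly R[n]}) :
  eqmod D p q -> eqmod D (r * p) (r * q).
Proof. exact/eqmodM/eqmod_refl. Qed.

Lemma eqmod_subr0 (R : comNzRingType) n D (p q : {mpoly R[n]}) :
  eqmod D p q <-> eqmod D (p - q) 0.
Proof.
split=> pq m lt; first by rewrite mcoeffB mcoeff0 (pq m lt) subrr.
by apply/eqP; rewrite -subr_eq0 -mcoeffB (pq m lt) mcoeff0.
Qed.

Lemma eqmod_pow0 (R : comNzRingType) n D (i : 'I_n) d :
  (D <= d)%N -> eqmod D ('X_i ^+ d : {mpoly R[n]}) 0.
Proof.
move=> le m lt; rewrite mpolyXn mcoeffX mcoeff0.
case: eqP => [mE|//].
by move: lt; rewrite -mE mdegMn mdeg1 mul1n ltnNge le.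
Qed.

Definition geom (R : comNzRingType) n (d : nat) (a : R) (i : 'I_n) : {mpoly R[n]} :=
  \sum_(k < d) (a *: 'X_i) ^+ k.

Lemma eqmod_geom (R : comNzRingType) n (D d d' : nat) (a : R) (i : 'I_n) :
  (D <= d)%N -> (D <= d')%N -> eqmod D (geom d a i) (geom d' a i).
Proof.
move=> le le'.
have le_geom k : eqmod D (geom (D + k) a i) (geom D a i).
  elim: k => [|k IHk]; first by rewrite addn0.
  rewrite addnS /geom big_ord_recr /= => m lt; rewrite mcoeffD exprZn mcoeffZ.
  by rewrite (eqmod_pow0 _ _ (leq_addr k D)) // mcoeff0 mulr0 addr0; apply: IHk.
move=> m lt; rewrite -(subnKC le) -(subnKC le') (le_geom _ _ lt).
by rewrite (le_geom _ _ lt).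
Qed.

Lemma geom_rec (R : comNzRingType) n (d : nat) (a : R) (i : 'I_n) :
  eqmod d (1 + a%:MP * 'X_i * geom d a i) (geom d a i).
Proof.
apply: (eqmod_trans _ (eqmod_geom a i (leqnSn d) (leqnn d))).
rewrite [geom d.+1 _ _]big_ord_recl expr0 mulr_sumr /=.
by under eq_bigr do rewrite mul_mpolyC -exprS.
Qed.

(* [geom L a k] stands for [1 / (1 - a X_k)]. *)
Lemma row_eqmod (K : fieldType) n L (w : vertex_weight K) (b : K)
    (T : nat -> 'rV[{mpoly K[n]}]_n) (tau : 'I_n -> {mpoly K[n]}) :
  free_fermionic w -> w true true true true = w true false true false * b ->
  (forall i k, (i < L)%N -> eqmod L (T i 0 k) (tau k * 'X_k ^+ i)) ->
  exists T' : nat -> 'rV[{mpoly K[n]}]_n,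
    (forall i k, (i < L)%N -> eqmod L (T' i 0 k)
       ((w true false true false)%:MP * ((1 + b *: 'X_k)
           * geom L (w false true false true) k) * tau k * 'X_k ^+ i))
    /\ forall v : L.-tuple bool,
      \sum_(v' : L.-tuple bool) (row_weight w false false v v')%:MP
        * wedge (occupied T 0 v')
      = wedge (occupied T' 0 v).
Proof.
move=> wff wb TE.
pose wR a b c d := (w a b c d)%:MP : {mpoly K[n]}.
have wRff : free_fermionic wR by apply: (free_fermionic_map (@mpolyC n K)).
have [_ _ wF] := wff.
set a := w false true false true in wF *.
set be := w true false true false in wF wb *.
set c1 := w true false false true in wF *.
set c2 := w false true true false in wF *.
(* With [E L = 0] the terms of [row_wedge] with an exiting path vanish. *)
have [E [EL recE]] := exists_carry L T a%:MP c2%:MP 0.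
have EE k i : (i <= L)%N -> eqmod L (E i 0 k) (c2%:MP * tau k * geom L a k * 'X_k ^+ i).
  move: i; apply: descending_ind => [|i lt IHi].
    rewrite EL mxE; apply: eqmod_sym.
    have := eqmodMl (c2%:MP * tau k * geom L a k) (eqmod_pow0 _ k (leqnn L)).
    by rewrite mulr0.
  rewrite recE // !mxE.
  apply: eqmod_trans (eqmodD (eqmodMl c2%:MP (TE i k lt)) (eqmodMl a%:MP IHi)) _.
  rewrite [X in eqmod _ _ X]mulrAC.
  apply: (eqmod_trans _ (eqmodMl (c2%:MP * tau k * 'X_k ^+ i) (@geom_rec _ _ L a k))).
  by rewrite exprS => m _; congr (mcoeff _ _); ring.
exists (fun i => be%:MP *: T i + c1%:MP *: E i.+1); split=> [i k lt|v]; last first.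
  rewrite -(row_wedge_tuple _ wRff recE); apply: eq_bigr => v' _.
  by rewrite EL (wedge0 [::]) mulr0 addr0 /wR row_weight_map.
rewrite !mxE.
apply: eqmod_trans
  (eqmodD (eqmodMl be%:MP (TE i k lt)) (eqmodMl c1%:MP (EE k i.+1 lt))) _.
have -> : be%:MP * ((1 + b *: 'X_k) * geom L a k) * tau k * 'X_k ^+ i
  = be%:MP * tau k * 'X_k ^+ i * (geom L a k + b%:MP * 'X_k * geom L a k).
  by rewrite -mul_mpolyC; ring.
apply: (eqmod_trans _
  (eqmodMl _ (eqmodD (@geom_rec _ _ L a k) (@eqmod_refl _ _ _ _)))).
(* The free-fermionic relation as [c1 c2 = be (a + b)], whence [be + c1 c2 X / (1 - a X) = be (1 + b
   X) / (1 - a X)]. *)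
have cc : c1%:MP * c2%:MP = be%:MP * b%:MP + be%:MP * a%:MP :> {mpoly K[n]}.
  by rewrite -!rmorphM -wF wb rmorphD !rmorphM.
move=> m _; congr (mcoeff _ _).
transitivity (be%:MP * tau k * 'X_k ^+ i
  + (c1%:MP * c2%:MP) * tau k * geom L a k * 'X_k ^+ i.+1 : {mpoly K[n]}); first by ring.
by rewrite cc exprS; ring.
Qed.

(** The top row acts on the powers first and the bottom row last; the factors of the rows above form
    the [tau] of [row_eqmod]. *)
Lemma transfer_eqmod (K : fieldType) n M L (w : 'I_M -> vertex_weight K)
    (b : 'I_M -> K) :
  (forall j, free_fermionic (w j)) ->
  (forall j, w j true true true true = w j true false true false * b j) ->
  exists T : nat -> 'rV[{mpoly K[n]}]_n,
    (forall i k, (i < L)%N -> eqmod L (T i 0 k)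
       ((\prod_j ((w j true false true false)%:MP * ((1 + b j *: 'X_k)
           * geom L (w j false true false true) k))) * 'X_k ^+ i))
    /\ forall v : L.-tuple bool,
      \sum_(t : L.-tuple bool)
        (transfer [seq w j | j <- enum 'I_M] false v t)%:MP
        * alt (fun i => 'X_i) t
      = wedge (occupied T 0 v).
Proof.
elim: M => [|M IHM] in w b *.
  move=> _ _; exists (powers (fun i => 'X_i)); split=> [i k _|v].
    by rewrite big_ord0 mul1r mxE.
  rewrite (size0nil (size_enum_ord 0)) /= (bigD1 v) //= eqxx mul1r big1 ?addr0 //.
  by move=> t ne; rewrite eq_sym (negbTE ne) mpolyC0 mul0r.
move=> wff wb.
have [T [TE TS]] := IHM (fun j => w (lift ord0 j)) (fun j => b (lift ord0 j))
  (fun j => wff _) (fun j => wb _).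
have [T' [T'E T'S]] := row_eqmod (wff ord0) (wb ord0) TE.
exists T'; split=> [i k lt|v]; first by rewrite big_ord_recl; apply: T'E.
rewrite -T'S enum_ordSl /= -map_comp; under [RHS]eq_bigr do rewrite -TS mulr_sumr.
rewrite exchange_big /=; apply: eq_bigr => t _.
rewrite rmorph_sum mulr_suml; apply: eq_bigr => v' _.
by rewrite rmorphM mulrA.
Qed.

(** The factor acquired by an entry depends only on its variable, not on the column, so it leaves
    the determinant row by row. *)
Lemma transfer_packed_eqmod (K : fieldType) n M L (w : 'I_M -> vertex_weight K)
    (b : 'I_M -> K) (v : L.-tuple bool) :
  (forall j, free_fermionic (w j)) ->
  (forall j, w j true true true true = w j true false true false * b j) ->
  size (positions v) = n ->
  eqmod L (\sum_(t : L.-tuple bool)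
        (transfer [seq w j | j <- enum 'I_M] false v t)%:MP
        * alt (fun i : 'I_n => 'X_i) t)
    ((\prod_j w j true false true false ^+ n)%:MP
     * ((\prod_(k < n) \prod_(j < M) ((1 + b j *: 'X_k)
         * geom L (w j false true false true) k))
        * alt (fun i : 'I_n => 'X_i) v)).
Proof.
move=> wff wb szv; have [T [TE ->]] := transfer_eqmod n L wff wb.
rewrite wedge_occupied // alt_det // rmorph_prod /=.
have -> : \prod_j (w j true false true false ^+ n)%:MP
   = \prod_(k < n) \prod_j (w j true false true false)%:MP :> {mpoly K[n]}.
  by rewrite prodr_const card_ord -prodrXl; under eq_bigr do rewrite rmorphXn.
rewrite mulrA -big_split /= -det_scale_rows; apply: eqmod_det => k i; rewrite !mxE.
rewrite -big_split /=; apply: TE.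
have : nth 0%N (positions v) i \in positions v by rewrite mem_nth // szv.
rewrite mem_positions; apply: contraTltn => le.
by rewrite nth_default // size_tuple.
Qed.

(** * Homogeneity and leading monomials *)

Lemma pihomogMl (R : comNzRingType) n d k (p q : {mpoly R[n]}) :
  p \is d.-homog -> pihomog mdeg (d + k) (p * q) = p * pihomog mdeg k q.
Proof.
move=> hp; set K := maxn (msize q) k.+1.
rewrite {1}(@pihomog_partitionE _ _ mdeg K q) ?leq_maxl // mulr_sumr raddf_sum /=.
have ltk : (k < K)%N by rewrite leq_max ltnSn orbT.
rewrite (bigD1 (Ordinal ltk)) //= big1 ?addr0 => [|i ne].
  by rewrite pihomog_dE // dhomogM // pihomogP.
apply: (@pihomog_ne0 _ _ _ (d + i)); last by rewrite dhomogM // pihomogP.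
by rewrite eqn_add2l; apply: contra ne => /eqP ik; apply/eqP/val_inj.
Qed.

Lemma mcoeff_pihomog (R : comNzRingType) n (q : {mpoly R[n]}) m :
  (pihomog mdeg (mdeg m) q)@_m = q@_m.
Proof.
set K := maxn (msize q) (mdeg m).+1.
have ltm : (mdeg m < K)%N by rewrite leq_max ltnSn orbT.
have /(congr1 (mcoeff m)) -> : q = \sum_(d < K) pihomog mdeg d q.
  by apply: pihomog_partitionE; apply: leq_maxl.
rewrite [RHS](raddf_sum (mcoeff m)) [RHS](bigD1 (Ordinal ltm)) //=.
rewrite [X in _ = _ + X]big1 ?addr0 // => i ne.
apply: (@dhomog_nemf_coeff _ _ mdeg i); first exact: pihomogP.
by apply: contra ne => /eqP im; apply/eqP/val_inj.
Qed.

(** Multiplication by [p] shifts homogeneous components by [d] and is injective, so cancelling [p]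
    costs exactly [d] degrees of precision. *)
Lemma eqmod_divr (K : fieldType) n d D (p q : {mpoly K[n]}) :
  p \is d.-homog -> p != 0 -> eqmod (d + D) (p * q) 0 -> eqmod D q 0.
Proof.
move=> hp p0 pq0 m lt; rewrite -mcoeff_pihomog mcoeff0.
suff -> : pihomog mdeg (mdeg m) q = 0 by rewrite mcoeff0.
apply: (mulfI p0); rewrite mulr0 -(pihomogMl _ _ hp) pihomogE big1 // => m' /eqP m'E.
by rewrite pq0 ?mcoeff0 ?scale0r // m'E ltn_add2l.
Qed.

Lemma prod_powers (R : comNzRingType) n (e : 'I_n -> nat) :
  \prod_i 'X_i ^+ e i = 'X_[[multinom e i | i < n]] :> {mpoly R[n]}.
Proof. by rewrite mpolyXE_id; apply: eq_bigr => i _; rewrite mnmE. Qed.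

Lemma alternantE (K : fieldType) n (lambda : signature n) :
  alternant K lambda = \sum_(s : 'S_n) (-1) ^+ s
    *: 'X_[[multinom (part lambda (s i) + (n - (s i).+1))%N | i < n]].
Proof.
apply: eq_bigr => s _; rewrite -prod_powers -mul_mpolyC rmorph_sign; congr (_ * _).
by apply: eq_bigr => i _; rewrite mxE.
Qed.

Definition weight_of n (lambda : signature n) : nat := \sum_j part lambda j.

Definition stair n : nat := \sum_(j < n) (n - j.+1).

Lemma dhomog_alternant (K : fieldType) n (lambda : signature n) :
  alternant K lambda \is (stair n + weight_of lambda).-homog.
Proof.
rewrite alternantE; apply: rpred_sum => s _; apply: dhomogZ.
rewrite dhomogX /= mdegE; under eq_bigr do rewrite mnmE.
rewrite (reindex_inj (@perm_inj _ (s^-1)%g)) /=.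
by under eq_bigr do rewrite permKV; rewrite big_split addnC.
Qed.

Lemma dhomog_vandermonde (K : fieldType) n : vandermonde K n \is (stair n).-homog.
Proof.
have := dhomog_alternant K (signature0 n).
rewrite alternant_signature0 /weight_of big1 ?addn0 // => j _.
by rewrite /part /= (tnth_nth 0%N) nth_nseq ltn_ord.
Qed.

Lemma schur_homog (K : fieldType) n (lambda : signature n) m :
  mdeg m != weight_of lambda -> (schur K lambda)@_m = 0.
Proof.
move=> ne; rewrite -mcoeff_pihomog.
suff -> : pihomog mdeg (mdeg m) (schur K lambda) = 0 by rewrite mcoeff0.
apply: (mulfI (vandermonde_neq0 K n)); rewrite mulr0.
rewrite -(pihomogMl _ _ (dhomog_vandermonde K n)) mulrC schurP.
by apply: (pihomog_ne0 _ (dhomog_alternant K lambda)); rewrite eqn_add2l eq_sym.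
Qed.

Definition top_monomial n (lambda : signature n) : 'X_{1..n} :=
  [multinom (part lambda i + (n - i.+1))%N | i < n].

Lemma mdeg_top_monomial n (lambda : signature n) :
  mdeg (top_monomial lambda) = (stair n + weight_of lambda)%N.
Proof.
by rewrite mdegE; under eq_bigr do rewrite mnmE; rewrite big_split addnC.
Qed.

Lemma columns_inj n (lambda : signature n) : injective
  (fun j : 'I_n => (part lambda j + (n - j.+1))%N).
Proof.
move=> i j eq_ij; apply: val_inj; have := ltn_ord i; have := ltn_ord j.
have := @part_le _ lambda i j; have := @part_le _ lambda j i.
by move: eq_ij; rewrite /=; case: (ltngtP i j) => //; lia.
Qed.

(** The exponents of an alternant are distinct and their set determines the signature, so only the
    identity permutation can produce a decreasing exponent vector. These coefficients serve as a
    dual basis. *)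
Lemma mcoeff_alternant (K : fieldType) n (lambda mu : signature n) :
  (alternant K lambda)@_(top_monomial mu) = (lambda == mu)%:R.
Proof.
rewrite alternantE raddf_sum /=.
have sE (s : 'S_n) :
    [multinom (part lambda (s i) + (n - (s i).+1))%N | i < n] = top_monomial mu ->
    lambda = mu /\ s = 1%g.
  move/mnmP => sE.
  have partE i : (part lambda (s i) + (n - (s i).+1) = part mu i + (n - i.+1))%N.
    by have := sE i; rewrite !mnmE.
  have eq_lm : lambda = mu.
    pose L := maxn (column_bound lambda) (column_bound mu).
    have ltl j : (part lambda j + (n - j.+1) < L)%N by rewrite leq_max lt_column_bound.
    have ltm j : (part mu j + (n - j.+1) < L)%N by rewrite leq_max lt_column_bound orbT.
    apply: (bits_inj ltl ltm); apply: positions_inj.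
    rewrite positions_bits //; apply/esym/eq_positions.
      by rewrite -(positions_bits ltl); apply: sorted_occupied.
    move=> k; rewrite -mem_positions positions_bits //.
    apply/mapP/mapP => -[j _ ->].
      by exists ((s^-1)%g j); rewrite ?mem_enum // -partE permKV.
    by exists (s j); rewrite ?mem_enum // partE.
  split=> //; apply/permP => i; rewrite perm1.
  by apply: (@columns_inj _ lambda); rewrite /= partE eq_lm.
case: (lambda =P mu) => [eq_lm|ne].
  subst mu.
  rewrite (bigD1 1%g) //= big1 ?addr0 => [|s ne]; last first.
    rewrite mcoeffZ mcoeffX; case: eqP => [/sE-[_ s1]|_]; last by rewrite mulr0.
    by rewrite s1 eqxx in ne.
  rewrite odd_perm1 expr0 scale1r mcoeffX.
  case: eqP => // -[]; apply/mnmP => i.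
  by rewrite !mnmE perm1.
apply: big1 => s _; rewrite mcoeffZ mcoeffX.
by case: eqP => [/sE-[] //|_]; rewrite mulr0.
Qed.

(** * Cauchy expansion of G *)

(** Through such a [sig], sums over signatures become finite sums over rows with [N] particles. *)
Definition inverse_bits N L (sig : L.-tuple bool -> signature N) : Prop :=
  forall t : L.-tuple bool, size (positions t) = N ->
    (forall j : 'I_N, part (sig t) j + (N - j.+1) < L)%N /\ bits (sig t) L = t.

Lemma exists_inverse_bits N L : exists sig, @inverse_bits N L sig.
Proof.
suff /boolp.choice[sig sigP] : forall t : L.-tuple bool, exists lambda : signature N,
    size (positions t) = N ->
    (forall j : 'I_N, part lambda j + (N - j.+1) < L)%N /\ bits lambda L = t.
  by exists sig.
move=> t; have [/signature_of_positions[lambda lE]|ne] :=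
  pselect (size (positions t) = N); first by exists lambda.
by exists (signature0 N).
Qed.

Lemma lt_weight N (lambda : signature N) L (j : 'I_N) :
  (N + weight_of lambda <= L)%N -> (part lambda j + (N - j.+1) < L)%N.
Proof. exact/leq_trans/lt_column_bound. Qed.

Definition truncated_sum (K : fieldType) N L (sig : L.-tuple bool -> signature N)
    (c : signature N -> K) : {mpoly K[N]} :=
  \sum_(t : L.-tuple bool | size (positions t) == N)
     c (sig t) *: schur K (sig t).

(** By homogeneity only signatures of weight [mdeg m] contribute, and their columns lie below
    [N + mdeg m]. *)
Lemma fsum_signatures (K : fieldType) N L (sig : L.-tuple bool -> signature N)
    (c : signature N -> K) m :
  inverse_bits sig -> (N + mdeg m <= L)%N ->
  \sum_(lambda \in [set: signature N]) c lambda * (schur K lambda)@_m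
  = (truncated_sum sig c)@_m.
Proof.
move=> sigP le_mL.
pose D := [set lambda : signature N |
  forall j : 'I_N, (part lambda j + (N - j.+1) < L)%N]%classic.
rewrite -(fsbig_widen D) //; last first.
  move=> lambda [_ far] /=; rewrite schur_homog ?mulr0 //.
  by apply/eqP => mE; apply: far => j; apply: lt_weight; rewrite -mE.
rewrite (reindex_fsbig sig [set t | size (positions t) == N]%classic); last first.
  split=> [t /eqP/sigP[] //|t t'|lambda ltl].
    move=> /set_mem/eqP/sigP[_ tE] /set_mem/eqP/sigP[_ t'E] eq_sig.
    by rewrite -tE -t'E eq_sig.
  have szl : size (positions (bits lambda L)) = N by rewrite positions_bits ?size_columns.
  exists (bits lambda L); rewrite /= ?szl //.
  by have [lt eq_bits] := sigP _ szl; apply: bits_inj eq_bits.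
rewrite fsum_fin raddf_sum /=; apply: eq_big => [t|t _].
  by apply/idP/idP => [/set_mem //|szt]; apply/mem_set.
by rewrite mcoeffZ.
Qed.

Lemma truncated_sum_vandermonde (K : fieldType) N L
    (sig : L.-tuple bool -> signature N) (c : signature N -> K) :
  inverse_bits sig ->
  vandermonde K N * truncated_sum sig c
  = \sum_(t : L.-tuple bool | size (positions t) == N)
      c (sig t) *: alternant K (sig t).
Proof.
move=> sigP; rewrite mulr_sumr; apply: eq_bigr => t _.
by rewrite -scalerAr mulrC schurP.
Qed.

(** Multiplied by the Vandermonde determinant, the expansion is a combination of alternants, and its
    coefficient at [top_monomial lambda] is [c lambda]. The width [L] keeps that monomial within
    precision. *)
Lemma cauchy_expansion_inj (K : fieldType) M N (a b : 'I_M -> K)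
    (c c' : signature N -> K) :
  cauchy_expansion a b c -> cauchy_expansion a b c' -> c = c'.
Proof.
move=> cE c'E; apply/funext => lambda.
pose L := (N + mdeg (top_monomial lambda)).+1.
have [sig sigP] := exists_inverse_bits N L.
have eq_sum : eqmod (L - N) (truncated_sum sig c) (truncated_sum sig c').
  move=> m lt; have le : (N + mdeg m <= L)%N by lia.
  by rewrite -!(fsum_signatures _ sigP le) cE c'E.
have ltL (j : 'I_N) : (part lambda j + (N - j.+1) < L)%N.
  by apply: lt_weight; rewrite /L mdeg_top_monomial; lia.
have szl : size (positions (bits lambda L)) = N by rewrite positions_bits ?size_columns.
have coefE d : (vandermonde K N * truncated_sum sig d)@_(top_monomial lambda)
    = d lambda.
  rewrite truncated_sum_vandermonde // raddf_sum /=.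
  have sigl : sig (bits lambda L) = lambda.
    by have [lt eq_bits] := sigP _ szl; apply: bits_inj eq_bits.
  rewrite (bigD1 (bits lambda L)) ?szl //= big1 ?addr0 => [|t /andP[/eqP szt ne]].
    by rewrite mcoeffZ mcoeff_alternant sigl eqxx mulr1.
  rewrite mcoeffZ mcoeff_alternant; case: eqP => [sigt|_]; last by rewrite mulr0.
  by case/eqP: ne; rewrite -sigt; have [_ ->] := sigP _ szt.
by rewrite -(coefE c) -(coefE c'); apply: (eqmodMl _ eq_sum); rewrite /L; lia.
Qed.

Lemma super_schur_eq (K : fieldType) M N (a b : 'I_M -> K) (c : signature N -> K) :
  cauchy_expansion a b c -> super_schur a b = c.
Proof.
move=> cE; rewrite /super_schur; case: xgetP => [c' _ c'E|/(_ c)//].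
exact: cauchy_expansion_inj c'E cE.
Qed.

(** Makes the alternant of the initial row of [G] the Vandermonde determinant itself. *)
Lemma packed_bits N L : (N <= L)%N ->
  [tuple (1 <= i.+1 <= N)%N | i < L] = bits (signature0 N) L.
Proof.
move=> le; apply: eq_from_tnth => i; rewrite !tnth_mktuple particlesS.
have part0 j : part (signature0 N) j = 0%N.
  by rewrite /part /= (tnth_nth 0%N) nth_nseq ltn_ord.
apply/idP/mapP => [/andP[_ lt]|[j _ ->]].
  exists (rev_ord (Ordinal lt)); rewrite ?mem_enum // part0 /=; lia.
by rewrite part0; have := ltn_ord j; lia.
Qed.

Lemma G_cauchy (K : fieldType) (M N : nat) (s : K) (x r a b : 'I_M -> K) :
  let w j := weight (x j) 1 (r j) s in
  (forall j, free_fermionic (w j)) ->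
  (forall j, w j true false true false != 0) ->
  (forall j, w j false true false true = a j) ->
  (forall j, w j true true true true = w j true false true false * b j) ->
  cauchy_expansion a b (fun lambda : signature N =>
    G lambda x (fun=> 1) r (fun=> s) / \prod_j w j true false true false ^+ N).
Proof.
move=> w wff w0 wa wb m; set B := \prod_j _.
pose c (lambda : signature N) := G lambda x (fun=> 1) r (fun=> s) / B.
have B0 : B != 0 by apply/prodf_neq0 => j _; rewrite expf_neq0.
(* [stair N] pays for the division by the Vandermonde determinant, and [N] leaves room for the
   columns of all signatures of weight [mdeg m]. *)
pose L := (N + stair N + mdeg m).+1.
have [sig sigP] := exists_inverse_bits N L.
have leNL : (N <= L)%N by rewrite /L; lia.
have lt0 (j : 'I_N) : (part (signature0 N) j + (N - j.+1) < L)%N.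
  by rewrite /part /= (tnth_nth 0%N) nth_nseq ltn_ord; lia.
have sz0 : size (positions (bits (signature0 N) L)) = N.
  by rewrite positions_bits ?size_columns.
transitivity (truncated_sum sig c)@_m.
  by apply: (fsum_signatures c sigP); rewrite /L; lia.
pose Phi d : {mpoly K[N]} := \prod_(i < N) \prod_(j < M)
  ((1 + b j *: 'X_i) * geom d (a j) i).
have cE (t : L.-tuple bool) : size (positions t) = N ->
    c (sig t) = transfer [seq w j | j <- enum 'I_M] false (bits (signature0 N) L) t / B.
  move=> szt; have [ltt eq_bits] := sigP t szt; congr (_ / _).
  rewrite /G -(packed_bits leNL) -[in RHS]eq_bits.
  apply: partition_function_transfer => //.
  - by move=> j i1 j1 i2 j2; apply: weight_nonconserving.
  - by move=> i le; apply/negbTE; lia.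
  - exact: particles_far.
have sumE : eqmod L (vandermonde K N * truncated_sum sig c)
    (vandermonde K N * Phi L).
  have := transfer_packed_eqmod (L := L) wff wb sz0.
  rewrite -(alternant_alt _ lt0) alternant_signature0 -/B => H.
  have -> : vandermonde K N * truncated_sum sig c = B^-1%:MP
      * \sum_(t : L.-tuple bool) (transfer [seq w j | j <- enum 'I_M] false
          (bits (signature0 N) L) t)%:MP * alt (fun i => 'X_i) t.
    rewrite truncated_sum_vandermonde // mulr_sumr.
    rewrite [RHS](bigID (fun t : L.-tuple bool => size (positions t) == N)) /=.
    rewrite [X in _ = _ + X]big1 ?addr0 => [|t ne]; last by rewrite alt_eq0 ?mulr0.
    apply: eq_bigr => t /eqP szt; have [ltt eq_bits] := sigP t szt.
    rewrite (alternant_alt _ ltt) eq_bits cE // mulrA -rmorphM mulrC.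
    by rewrite mul_mpolyC.
  apply: eqmod_trans (eqmodMl _ H) _.
  have PhiE : \prod_(k < N) \prod_(j < M) ((1 + b j *: 'X_k)
         * geom L (w j false true false true) k) = Phi L.
    by apply: eq_bigr => i _; apply: eq_bigr => j _; rewrite wa.
  rewrite PhiE mulrA -rmorphM mulVf // mul1r mulrC.
  exact: eqmod_refl.
have sumE' : eqmod (mdeg m).+1 (truncated_sum sig c) (Phi L).
  apply/eqmod_subr0.
  apply: (eqmod_divr (dhomog_vandermonde K N) (vandermonde_neq0 K N)).
  rewrite mulrBr => m' lt; move/eqmod_subr0: sumE; apply.
  by apply: leq_trans lt _; rewrite /L; lia.
rewrite sumE' // /cauchy_coef.
apply: (eqmod_prod (D := (mdeg m).+1)) => // i _.
apply: eqmod_prod => j _; apply/eqmodMl/eqmod_geom => //.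
by rewrite /L; lia.
Qed.

Theorem proposition1p2 (K : fieldType) (s : K) (N : nat) (lambda : signature N) :
  s != 0 ->
  (forall (x r : 'I_N -> K),
     (forall j, r j != 0) ->
     (forall j, 1 - s ^+ 2 * x j != 0) ->
     (forall j, 1 - x j != 0) ->
     F (signature0 N) x (fun=> 1) r (fun=> s) != 0 ->
     F lambda x (fun=> 1) r (fun=> s)
       / F (signature0 N) x (fun=> 1) r (fun=> s)
     = schur_eval lambda
         (fun j => (1 - s ^+ 2 * x j) / (s ^+ 2 * (1 - x j))))
  /\
  (forall (M : nat) (x r : 'I_M -> K),
     (1 <= M)%N ->
     (forall j, r j != 0) ->
     (forall j, 1 - s ^+ 2 * x j != 0) ->
     (forall j, 1 - s ^+ 2 * r j ^- 2 * x j != 0) ->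
     G lambda x (fun=> 1) r (fun=> s)
     = super_schur
         (fun j => s ^+ 2 * (1 - x j) / (1 - s ^+ 2 * x j))
         (fun j => s ^+ 2 * (x j * r j ^- 2 - 1)
                   / (1 - s ^+ 2 * r j ^- 2 * x j))
         lambda
       * \prod_(i < M)
           ((1 - s ^+ 2 * r i ^- 2 * x i) / (1 - s ^+ 2 * x i)) ^+ N).
Proof.
move=> s0; split=> [x r r0 xs x1|M x r _ r0 xs xrs]; first exact: F_schur.
(* In terms of the weights of row [j], [a j] is [w0101] and [b j] is [w1111 / w1010]; the product in
   the claim consists of the [w1010], one for each of the [N] paths. *)
set a := fun j => _ / _; set b := fun j => _ / _.
pose w j := weight (x j) 1 (r j) s.
have wff j : free_fermionic (w j) by exact: weight_free_fermionic.
have stayE j : w j true false true false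
    = (1 - s ^+ 2 * r j ^- 2 * x j) / (1 - s ^+ 2 * x j).
  by rewrite /w /=; field; rewrite xs s0 r0.
have stay_neq0 j : w j true false true false != 0.
  by rewrite stayE mulf_neq0 ?invr_neq0.
have aE j : w j false true false true = a j.
  by rewrite /w /a /=; field; rewrite xs s0.
have bE j : w j true true true true = w j true false true false * b j.
  have xr : r j ^+ 2 - s ^+ 2 * x j != 0.
    apply: contraNneq (xrs j) => /eqP; rewrite subr_eq0 => /eqP rE.
    by rewrite mulrAC -rE divff ?subrr // expf_neq0.
  by rewrite /w /b /=; field; rewrite xr s0 r0 mulNr (mulrC (x j)) xs.
rewrite (super_schur_eq (@G_cauchy _ M N s x r a b wff stay_neq0 aE bE)).
have -> : \prod_(i < M) ((1 - s ^+ 2 * r i ^- 2 * x i) / (1 - s ^+ 2 * x i)) ^+ N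
    = \prod_j w j true false true false ^+ N.
  by apply: eq_bigr => j _; rewrite stayE.
rewrite divfK //; apply/prodf_neq0 => j _.
exact: expf_neq0 (stay_neq0 j).
Qed.
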